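(* Let $(L,\triangleright)$ be a graded left pre-Lie algebra over a field of characteristic zero, and let $d\in\operatorname{Der}(L,[\cdot,\cdot])$ be a (homogeneous) derivation of the associated graded Lie algebra. Then the Kapranov brackets $\mathcal{K}(d)_n:L^{\odot n}\to L$, $n\ge 0$, associated to $d$ are determined by the recursion $$\mathcal{K}(d)_0=0,\qquad \mathcal{K}(d)_1=d,\qquad \mathcal{K}(d)_2(x\odot y)=\nabla_{dx}(y)-[d,\nabla_x](y),$$ $$\mathcal{K}(d)_{n+1}(x\odot y_1\odot\cdots\odot y_n)=-[\mathcal{K}(d)_n,\nabla_x](y_1\odot\cdots\odot y_n)\qquad\text{for } n\ge2,$$ for all $x,y,y_1,\ldots,y_n\in L$, where the brackets on the right hand sides are Nijenhuis-Richardson brackets.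
   Context: All spaces are $\mathbb{Z}$-graded over a field $\mathbb{K}$ of characteristic zero, with the Koszul sign rule. A graded left pre-Lie algebra $(L,\triangleright)$ is a graded space with a degree zero bilinear product whose associator $A(x,y,z)=(x\triangleright y)\triangleright z-x\triangleright(y\triangleright z)$ satisfies $A(x,y,z)=(-1)^{|x||y|}A(y,x,z)$. The associated graded Lie bracket is $[x,y]=x\triangleright y-(-1)^{|x||y|}y\triangleright x$, and $\nabla_x(y):=x\triangleright y$. $SL=\oplus_{n\ge0}L^{\odot n}$ is the symmetric coalgebra with the unshuffle coproduct, $p:SL\to L$ the projection. Coderivations $Q$ of $SL$ correspond bijectively to their Taylor coefficients $Q_n=q_n:L^{\odot n}\to L$, $n\ge0$ (the components of $pQ$), via $Q(v_1\odot\cdots\odot v_n)=\sum_{i=0}^n\sum_{\sigma\in S(i,n-i)}\varepsilon(\sigma)q_i(v_{\sigma(1)}\odot\cdots\odot v_{\sigma(i)})\odot v_{\sigma(i+1)}\odot\cdots\odot v_{\sigma(n)}$ ($S(i,n-i)$ = unshuffles, $\varepsilon(\sigma)$ = Koszul sign). The Nijenhuis-Richardson bracket on $\operatorname{Coder}(SL)$ is the graded commutator of coderivations. A map $L^{\odot n}\to L$ is regarded as the coderivation with that single Taylor coefficient; in particular an endomorphism $f:L\to L$ is regarded as a linear coderivation on $SL$. Thus $[d,\nabla_x]=d\nabla_x-(-1)^{|d||x|}\nabla_x d$, and for $q:L^{\odot n}\to L$, $[q,\nabla_x](y_1\odot\cdots\odot y_n)=\sum_{i=1}^n(-1)^{|x|(|y_1|+\cdots+|y_{i-1}|)}q(y_1\odot\cdots\odot\nabla_x(y_i)\odot\cdots\odot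 y_n)-(-1)^{|q||x|}\nabla_x(q(y_1\odot\cdots\odot y_n))$. For $x\in L$ let $\sigma_x=x\odot-:SL\to SL$ and $s(x):=\sigma_x+\nabla_x\in\operatorname{Coder}(SL)$ (with $\nabla_x$ regarded as a linear coderivation). Let $(UL,\ast)$ be the universal enveloping algebra of $(L,[\cdot,\cdot])$. Let $\eta:UL\to SL$, $\eta(1)=1$, $\eta(x_1\ast\cdots\ast x_n)=s(x_1)\cdots s(x_n)(1)$, and $\operatorname{sym}:SL\to UL$, $\operatorname{sym}(1)=1$, $\operatorname{sym}(x_1\odot\cdots\odot x_n)=\frac1{n!}\sum_{\sigma\in S_n}\varepsilon(\sigma)x_{\sigma(1)}\ast\cdots\ast x_{\sigma(n)}$; both are isomorphisms of coaugmented coalgebras. The exponential automorphism is $E:=\eta\circ\operatorname{sym}:SL\to SL$. For $Q\in\operatorname{Coder}(SL)$ put $\mathcal{K}(Q):=EQE^{-1}\in\operatorname{Coder}(SL)$. For an endomorphism $f:L\to L$, the Kapranov brackets associated to $f$ are the Taylor coefficients $\mathcal{K}(f)_n:L^{\odot n}\to L$ of $\mathcal{K}(f)$. *)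

(* Defs.v *)
From HB Require Import structures.
From mathcomp Require Import all_boot all_order all_algebra perm.
From mathcomp Require Import boolp classical_sets.
From mathcomp Require Import finmap monalg.

Set Implicit Arguments.
Unset Strict Implicit.
Unset Printing Implicit Defensive.

Import GRing.Theory.
Local Open Scope ring_scope.
Local Open Scope quotient_scope.

(* A direct sum decomposition V = (+)_i V_i, i in Z, is given by the projections
   [gpart i] of V onto the summands V_i. *)
HB.mixin Record Lmodule_isGraded (K : fieldType) V of GRing.Lmodule K V := {
  gpart : int -> V -> V;
  gpart_linear : forall i, linear (gpart i);
  gpartK : forall i j v, gpart i (gpart j v) = if i == j then gpart j v else 0;
  gpart_sum : forall v,
    exists s : seq int, uniq s && (v == \sum_(i <- s) gpart i v)
}.

#[short(type="gradedLmodType")]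
HB.structure Definition GradedLmodule (K : fieldType) :=
  {V of GRing.Lmodule K V & Lmodule_isGraded K V}.

Section Graded.
Variables (K : fieldType) (V : gradedLmodType K).

Definition homog (i : int) (v : V) : bool := gpart i v == v.

Lemma homog_gpart i v : homog i (gpart i v).
Proof. by rewrite /homog gpartK eqxx. Qed.

(* A finite set of degrees outside of which all the components of v vanish. *)
Definition gsupp (v : V) : seq int := xchoose (gpart_sum v).

(* Homogeneous elements together with their degree, so that 0 occurs once in
   each degree. *)
Definition hom_elt : Type := {u : int * V | homog u.1 u.2}.
HB.instance Definition _ := Choice.on hom_elt.

Definition hdeg (x : hom_elt) : int := (val x).1.
Definition hval (x : hom_elt) : V := (val x).2.
Definition hpart (i : int) (v : V) : hom_elt :=
  exist (fun u => homog u.1 u.2) (i, gpart i v) (homog_gpart i v).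

End Graded.

Arguments hom_elt {K} V.

Definition ksign (K : fieldType) (i j : int) : K := (-1) ^ (i * j).
Arguments ksign {K} i j.

(* The pre-Lie identity A(x,y,z) = (-1)^(|x||y|) A(y,x,z) is only required for
   homogeneous x and y; z is arbitrary. *)
HB.mixin Record GradedLmodule_isPreLie (K : fieldType) L
    of GradedLmodule K L := {
  prelie : L -> L -> L;
  prelie_linearl : forall y, linear (prelie^~ y);
  prelie_linearr : forall x, linear (prelie x);
  prelie_homog : forall i j x y,
    homog i x -> homog j y -> homog (i + j) (prelie x y);
  prelie_assoc : forall i j x y z, homog i x -> homog j y ->
    prelie (prelie x y) z - prelie x (prelie y z) =
      ksign i j *: (prelie (prelie y x) z - prelie y (prelie x z))
}.

#[short(type="preLieType")]
HB.structure Definition PreLie (K : fieldType) :=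
  {L of GradedLmodule K L & GradedLmodule_isPreLie K L}.

Infix "▷" := prelie (at level 40, left associativity) : ring_scope.

(* The quotient of an algebra A by the two-sided ideal generated by R. It may be
   the zero ring, hence the [pzRingType] structure. *)
Section QuotientAlgebra.
Variables (K : fieldType) (A : lalgType K) (R : A -> Prop).

Inductive ideal_span : A -> Prop :=
| Ideal0 : ideal_span 0
| IdealD x y : ideal_span x -> ideal_span y -> ideal_span (x + y)
| IdealM a r b : R r -> ideal_span (a * r * b).

Definition ideal : {pred A} := fun x => `[< ideal_span x >].

Lemma idealP x : reflect (ideal_span x) (x \in ideal).
Proof. exact: asboolP. Qed.

Lemma ideal_addr : addr_closed ideal.
Proof.
split=> [|x y /idealP Ix /idealP Iy]; apply/idealP; first exact: Ideal0.
exact: IdealD.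
Qed.
HB.instance Definition _ := GRing.isAddClosed.Build A ideal ideal_addr.

Lemma ideal_Ml a x : x \in ideal -> a * x \in ideal.
Proof.
move=> /idealP Ix; apply/idealP; elim: Ix => [|y z _ Iy _ Iz|b r c Rr].
- by rewrite mulr0; exact: Ideal0.
- by rewrite mulrDr; exact: IdealD.
- by rewrite !mulrA; exact: IdealM.
Qed.

Lemma ideal_Mr a x : x \in ideal -> x * a \in ideal.
Proof.
move=> /idealP Ix; apply/idealP; elim: Ix => [|y z _ Iy _ Iz|b r c Rr].
- by rewrite mul0r; exact: Ideal0.
- by rewrite mulrDl; exact: IdealD.
- by rewrite -mulrA; exact: IdealM.
Qed.

Lemma ideal_oppr : oppr_closed ideal.
Proof. by move=> x Ix; rewrite -mulN1r ideal_Ml. Qed.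
HB.instance Definition _ := GRing.isOppClosed.Build A ideal ideal_oppr.

Lemma ideal_Z c x : x \in ideal -> c *: x \in ideal.
Proof. by move=> Ix; rewrite -[x]mul1r scalerAl ideal_Ml. Qed.

Definition quotalg : Type := {ideal_quot ideal}.
HB.instance Definition _ := GRing.Zmodule.on quotalg.
HB.instance Definition _ := EqQuotient.on quotalg.
HB.instance Definition _ := ZmodQuotient.on quotalg.

Lemma quotalg_eqP x y :
  reflect (\pi_quotalg x = \pi_quotalg y) (x - y \in ideal).
Proof.
rewrite Quotient.idealrBE.
exact: eqP.
Qed.

Definition quotalg_one : quotalg := lift_cst quotalg 1.
Definition quotalg_mul := lift_op2 quotalg *%R.
Definition quotalg_scale (c : K) := lift_op1 quotalg ( *:%R c).

Canonical quotalg_pi1_morph := PiConst quotalg_one.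

Lemma quotalg_piM : {morph \pi_quotalg : x y / x * y >-> quotalg_mul x y}.
Proof.
move=> x y; unlock quotalg_mul; apply/quotalg_eqP.
set x' := repr _; set y' := repr _.
have /quotalg_eqP Ix : \pi_quotalg x = \pi_quotalg x' by rewrite reprK.
have /quotalg_eqP Iy : \pi_quotalg y = \pi_quotalg y' by rewrite reprK.
rewrite -[x * y](subrK (x' * y)) -mulrBl -addrA -mulrBr.
by rewrite rpredD; [|rewrite ideal_Mr|rewrite ideal_Ml].
Qed.
Canonical quotalg_piM_morph := PiMorph2 quotalg_piM.

Lemma quotalg_piZ c : {morph \pi_quotalg : x / c *: x >-> quotalg_scale c x}.
Proof.
move=> x; unlock quotalg_scale; apply/quotalg_eqP; rewrite -scalerBr ideal_Z //.
by apply/quotalg_eqP; rewrite reprK.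
Qed.
Canonical quotalg_piZ_morph c := PiMorph1 (quotalg_piZ c).

Lemma quotalg_mulA : associative quotalg_mul.
Proof. by move=> x y z; rewrite -[x]reprK -[y]reprK -[z]reprK !piE mulrA. Qed.
Lemma quotalg_mul1 : left_id quotalg_one quotalg_mul.
Proof. by move=> x; rewrite -[x]reprK !piE mul1r. Qed.
Lemma quotalg_mulr1 : right_id quotalg_one quotalg_mul.
Proof. by move=> x; rewrite -[x]reprK !piE mulr1. Qed.
Lemma quotalg_mulDl : left_distributive quotalg_mul +%R.
Proof.
by move=> x y z; rewrite -[x]reprK -[y]reprK -[z]reprK !piE mulrDl.
Qed.
Lemma quotalg_mulDr : right_distributive quotalg_mul +%R.
Proof.
by move=> x y z; rewrite -[x]reprK -[y]reprK -[z]reprK !piE mulrDr.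
Qed.
HB.instance Definition _ := GRing.Zmodule_isPzRing.Build quotalg
  quotalg_mulA quotalg_mul1 quotalg_mulr1 quotalg_mulDl quotalg_mulDr.

Lemma quotalg_scaleA a b v :
  quotalg_scale a (quotalg_scale b v) = quotalg_scale (a * b) v.
Proof. by rewrite -[v]reprK !piE scalerA. Qed.
Lemma quotalg_scale1 : left_id 1 quotalg_scale.
Proof. by move=> v; rewrite -[v]reprK !piE scale1r. Qed.
Lemma quotalg_scaleDr : right_distributive quotalg_scale +%R.
Proof. by move=> a u v; rewrite -[u]reprK -[v]reprK !piE scalerDr. Qed.
Lemma quotalg_scaleDl v : {morph quotalg_scale^~ v : a b / a + b}.
Proof. by move=> a b; rewrite -[v]reprK !piE scalerDl. Qed.
HB.instance Definition _ := GRing.Zmodule_isLmodule.Build K quotalg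
  quotalg_scaleA quotalg_scale1 quotalg_scaleDr quotalg_scaleDl.

End QuotientAlgebra.

(* The free associative algebra on the set X; its monomials are words in X. *)
Notation freealg K X := {malg K[{fmonom X}]}.

Section FreeAlgebra.
Variables (K : fieldType) (X : choiceType).

Definition letter (x : X) : freealg K X := << fmu x >>.

Definition linext (V : lmodType K) (f : seq X -> V) (t : freealg K X) : V :=
  \sum_(w <- msupp t) t@_w *: f w.

(* The map induced by [linext f] on a quotient of the free algebra: by
   [quotext_pi] below, the choice of the representative is irrelevant as soon as
   [linext f] vanishes on the ideal generated by R. *)
Definition quotext (R : freealg K X -> Prop) (V : lmodType K) (f : seq X -> V)
  (u : quotalg R) : V := linext f (repr u).

Lemma linext_linear (V : lmodType K) (f : seq X -> V) : linear (linext f).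
Proof.
have linextE (E : {fset {fmonom X}}) g :
    (forall w, w \notin E -> g@_w = 0) ->
    linext f g = \sum_(w <- E) g@_w *: f w.
  move=> gE; rewrite /linext; apply: big_fset_incl => [|w _ /mcoeff_outdom ->].
    apply/fsubsetP => w; apply: contraLR => /gE /eqP.
    by rewrite mcoeff_eq0.
  by rewrite scale0r.
move=> a g h; pose E := (msupp g `|` msupp h)%fset.
have gE w : w \notin E -> g@_w = 0.
  by rewrite in_fsetU negb_or => /andP[/mcoeff_outdom].
have hE w : w \notin E -> h@_w = 0.
  by rewrite in_fsetU negb_or => /andP[_ /mcoeff_outdom].
rewrite !(@linextE E) // => [|w wE]; last first.
  by rewrite mcoeffD mcoeffZ gE // hE // mulr0 addr0.
rewrite scaler_sumr -big_split /=; apply: eq_bigr => w _.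
by rewrite mcoeffD mcoeffZ scalerDl scalerA.
Qed.

Lemma quotext_pi (R : freealg K X -> Prop) (V : lmodType K) (f : seq X -> V)
    (t : freealg K X) :
  (forall a r b, R r -> linext f (a * r * b) = 0) ->
  quotext f (\pi_(quotalg R) t) = linext f t.
Proof.
move=> fR; have lin := linext_linear f.
have f0 : linext f 0 = 0.
  by have := lin (-1) 0 0; rewrite scaler0 addr0 scaleN1r addNr.
have fD x y : linext f (x + y) = linext f x + linext f y.
  by have := lin 1 x y; rewrite !scale1r.
have f_ideal x : ideal_span R x -> linext f x = 0.
  by elim=> [//|y z _ fy _ fz|a r b]; [rewrite fD fy fz addr0|exact: fR].
rewrite /quotext; set u := repr _.
have /quotalg_eqP/idealP/f_ideal fB : \pi_(quotalg R) u = \pi_(quotalg R) t.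
  by rewrite /u reprK.
by rewrite -[u](subrK t) fD fB add0r.
Qed.

End FreeAlgebra.

Arguments letter {K X} x.
Arguments quotext {K X R V} f u.

(* SL: generated by the homogeneous elements of L, modulo linearity in each
   degree and graded commutativity. *)
Section Symmetric.
Variables (K : fieldType) (L : gradedLmodType K).

Inductive sym_rel : freealg K (hom_elt L) -> Prop :=
| SymLinear i (a : K) (x y : L) :
    sym_rel (letter (hpart i (a *: x + y))
             - a *: letter (hpart i x) - letter (hpart i y))
| SymComm (x y : hom_elt L) :
    sym_rel (letter x * letter y
             - ksign (hdeg x) (hdeg y) *: (letter y * letter x)).

Definition SymCoalg : Type := quotalg sym_rel.
HB.instance Definition _ := GRing.PzRing.on SymCoalg.
HB.instance Definition _ := GRing.Lmodule.on SymCoalg.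

Definition sletter (x : hom_elt L) : SymCoalg := \pi_(quotalg sym_rel) (letter x).

Definition smonom (w : seq (hom_elt L)) : SymCoalg := \prod_(x <- w) sletter x.

(* The inclusion of L into SL. *)
Definition siota (x : L) : SymCoalg := \sum_(i <- gsupp x) sletter (hpart i x).

Definition sproj : SymCoalg -> L :=
  quotext (fun w => if w is [:: x] then hval x else 0).

(* The projection of SL onto its summand L^{(.) n}. *)
Definition sympart (n : nat) : SymCoalg -> SymCoalg :=
  quotext (fun w => if size w == n then smonom w else 0).

Definition permw (w : seq (hom_elt L)) (s : 'S_(size w)) : seq (hom_elt L) :=
  [seq tnth (in_tuple w) (s i) | i <- enum 'I_(size w)].

(* The sign such that, for w = v_1 ... v_n,
   v_1 (.) ... (.) v_n = koszul w s *: (v_(s 1) (.) ... (.) v_(s n)). *)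
Definition koszul (w : seq (hom_elt L)) (s : 'S_(size w)) : K :=
  \prod_(i < size w) \prod_(j < size w | (i < j)%N && (s j < s i)%N)
    ksign (hdeg (tnth (in_tuple w) (s i))) (hdeg (tnth (in_tuple w) (s j))).

Arguments permw : clear implicits.
Arguments koszul : clear implicits.

(* s is increasing on the first i positions and on the remaining ones. *)
Definition unshuffle (n i : nat) (s : 'S_n) : bool :=
  [forall a : 'I_n, forall b : 'I_n,
    ((a < b)%N && ((b < i)%N || (i <= a)%N)) ==> (s a < s b)%N].

(* A map L^{(.) n} -> L of degree k is represented by a map on SL which
   vanishes on the other summands. *)
Definition symmap (n : nat) (k : int) (q : SymCoalg -> L) : Prop :=
  [/\ linear q,
      forall v, q (sympart n v) = q v
    & forall w : seq (hom_elt L),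
        homog (k + \sum_(x <- w) hdeg x) (q (smonom w))].

(* The coderivation with Taylor coefficients q_0, q_1, ... *)
Definition coder (q : nat -> SymCoalg -> L) : SymCoalg -> SymCoalg :=
  quotext (fun w =>
    \sum_(i < (size w).+1) \sum_(s : 'S_(size w) | unshuffle i s)
    koszul w s *: (siota (q i (smonom (take i (permw w s))))
                 * smonom (drop i (permw w s)))).

(* The restriction of p Q to L^{(.) n}, extended by zero. *)
Definition taylor (Q : SymCoalg -> SymCoalg) (n : nat) : SymCoalg -> L :=
  fun v => sproj (Q (sympart n v)).

(* The coderivation whose only nonzero Taylor coefficient is q : L^{(.) n} -> L. *)
Definition coder1 (n : nat) (q : SymCoalg -> L) : SymCoalg -> SymCoalg :=
  coder (fun i => if i == n then q else fun=> 0).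

Definition lincoder (f : L -> L) : SymCoalg -> SymCoalg := coder1 1 (f \o sproj).

(* The Nijenhuis-Richardson bracket of coderivations of degrees k and l. *)
Definition nrbracket (k l : int) (Q R : SymCoalg -> SymCoalg) : SymCoalg -> SymCoalg :=
  fun v => Q (R v) - ksign k l *: R (Q v).

End Symmetric.

Arguments permw {K L} w s.
Arguments koszul {K L} w s.

Section Enveloping.
Variables (K : fieldType) (L : preLieType K).

(* The bilinear extension of [x,y] = x ▷ y - (-1)^(|x||y|) y ▷ x from
   homogeneous x and y to all of L. *)
Definition lieb (x y : L) : L :=
  \sum_(i <- gsupp x) \sum_(j <- gsupp y)
    (gpart i x ▷ gpart j y - ksign i j *: (gpart j y ▷ gpart i x)).

(* UL: generated by the homogeneous elements of L, modulo linearity in each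
   degree and x * y - (-1)^(|x||y|) y * x = [x,y]. *)
Inductive env_rel : freealg K (hom_elt L) -> Prop :=
| EnvLinear i (a : K) (x y : L) :
    env_rel (letter (hpart i (a *: x + y))
             - a *: letter (hpart i x) - letter (hpart i y))
| EnvBracket (x y : hom_elt L) :
    env_rel (letter x * letter y
             - ksign (hdeg x) (hdeg y) *: (letter y * letter x)
             - letter (hpart (hdeg x + hdeg y) (lieb (hval x) (hval y)))).

Definition EnvAlg : Type := quotalg env_rel.
HB.instance Definition _ := GRing.PzRing.on EnvAlg.
HB.instance Definition _ := GRing.Lmodule.on EnvAlg.

Definition eletter (x : hom_elt L) : EnvAlg := \pi_(quotalg env_rel) (letter x).

Definition lie_derivation (k : int) (d : L -> L) : Prop :=
  [/\ linear d,
      forall i x, homog i x -> homog (k + i) (d x)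
    & forall i x y, homog i x ->
        d (lieb x y) = lieb (d x) y + ksign k i *: lieb x (d y)].

(* nabla_x and s(x) = sigma_x + nabla_x as operators on SL *)
Definition nablac (x : L) : SymCoalg L -> SymCoalg L := lincoder (prelie x).

Definition sop (x : L) (v : SymCoalg L) : SymCoalg L := siota x * v + nablac x v.

(* x_1 * ... * x_n |-> s(x_1) ... s(x_n)(1) *)
Definition eta : EnvAlg -> SymCoalg L :=
  quotext (fun w => foldr (fun x => sop (hval x)) 1 w).

Definition symz : SymCoalg L -> EnvAlg :=
  quotext (fun w => ((size w)`!%:R)^-1 *:
    \sum_(s : 'S_(size w)) koszul w s *: \prod_(x <- permw w s) eletter x).

(* E = eta o sym; E is bijective, and its inverse picks preimages. *)
Definition expaut : SymCoalg L -> SymCoalg L := eta \o symz.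

Definition expaut_inv (v : SymCoalg L) : SymCoalg L := xget 0 [set u | expaut u = v]%classic.

Definition kmap (Q : SymCoalg L -> SymCoalg L) : SymCoalg L -> SymCoalg L :=
  expaut \o Q \o expaut_inv.

Definition kapranov (f : L -> L) (n : nat) : SymCoalg L -> L :=
  taylor (kmap (lincoder f)) n.

End Enveloping.

(* Main.v *)
Require Import Defs.
From mathcomp Require Import all_boot all_order all_algebra perm ssrAC.
From mathcomp Require Import boolp classical_sets.
From mathcomp Require Import finmap monalg.

(** The proof rests on one commutation relation. The operators s(x) = sigma_x +
nabla_x satisfy [s(x), s(y)] = s([x,y]) (lemma [sop_comm]; this is where the
pre-Lie identity enters), so SL is a module over UL, and eta is the action of UL
on 1. Being a derivation of the Lie bracket, d extends to a derivation [envder] of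
UL, which corresponds under symmetrization to the coderivation d of SL
([symz_lincoder]). Hence K(d) = E d E^-1 corresponds to [envder] under eta, and
since [envder] maps x * u to dx * u + (-1)^(|d||x|) x * [envder] u, one gets

  K(d) s(x) = s(dx) + (-1)^(|d||x|) s(x) K(d)      (lemma [kap_sop])

together with K(d) 1 = 0. Solving for K(d) on x (.) v, where s(x) v = x (.) v +
nabla_x v, and projecting to L gives for v of length n

  K(d)_(n+1) (x (.) v) = p (s(dx) v) - [K(d)_n, nabla_x] v,

because the remaining term p (x (.) K(d) v) involves only the component of K(d) v
in the ground field, which vanishes ([sconst_kap]). Here p (s(dx) v) is dx for n =
0, dx |> v for n = 1 and 0 for n >= 2: this is the recursion ([kapr_siotaM]). The
recursion determines the brackets, as the products x (.) v span SL, and it shows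
inductively that they are homogeneous.

The relation makes sense once E is known to be bijective. Modulo shorter words
s(x) is multiplication by x and the letters of a monomial of UL commute up to
sign, so E is the identity modulo shorter words ([expaut_low]), hence invertible,
and symmetrization is onto ([symz_surj]); characteristic zero is used to divide by
n!.

All these maps are given by formulas on words of homogeneous elements. A map on
words is written in a form that permits induction on the word: symmetrization
inserts the letters one by one ([winsert], [wsymm_cons]), a derivation is applied
letter by letter ([wderiv]), and the two commute ([wsymm_wderiv]). The relations
of SL and of UL become the conditions [wlin] and [wcomm] on functions of words. *)
Set Implicit Arguments.
Unset Strict Implicit.
Unset Printing Implicit Defensive.

Import GRing.Theory.
Local Open Scope ring_scope.
Local Open Scope quotient_scope.

(** * Linear maps given as predicates *)

Section LinearPredicate.
Variables (K : fieldType) (U V : lmodType K) (f : U -> V).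
Hypothesis lin_f : linear f.

Lemma linD x y : f (x + y) = f x + f y.
Proof. by have := lin_f 1 x y; rewrite !scale1r. Qed.

Lemma lin0 : f 0 = 0.
Proof. by apply: (@addrI _ (f 0)); rewrite -linD !addr0. Qed.

Lemma linZ a x : f (a *: x) = a *: f x.
Proof. by rewrite -[a *: x]addr0 lin_f lin0 addr0. Qed.

Lemma linN x : f (- x) = - f x.
Proof. by rewrite -scaleN1r linZ scaleN1r. Qed.

Lemma linB x y : f (x - y) = f x - f y.
Proof. by rewrite linD linN. Qed.

Lemma lin_sum (I : Type) (r : seq I) (P : pred I) (F : I -> U) :
  f (\sum_(i <- r | P i) F i) = \sum_(i <- r | P i) f (F i).
Proof. by apply: (big_morph f linD lin0). Qed.

End LinearPredicate.

Lemma lin_comp (K : fieldType) (U V W : lmodType K) (f : V -> W) (g : U -> V) :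
  linear f -> linear g -> linear (fun a => f (g a)).
Proof. by move=> lf lg c a b; rewrite lg lf. Qed.

Lemma lin_comb (K : fieldType) (U V : lmodType K) (f g : U -> V) (c : K) :
  linear f -> linear g -> linear (fun a => c *: f a + g a).
Proof.
by move=> lf lg c' a b; rewrite lf lg !scalerDr !scalerA mulrC addrACA.
Qed.

(** * Quotients of the free algebra *)

Section FreeAlgebraWords.
Variables (K : fieldType) (X : choiceType).
Implicit Types (u v w : seq X) (a b t : freealg K X).

Lemma malgZU c z (k : {fmonom X}) : c *: << z *g k >> = << c * z *g k >> :> freealg K X.
Proof. by rewrite -mul_malgC malgM_def fgmulUU Monoid.mul1m. Qed.

Lemma malg_scalerAl c a b : (c *: a) * b = c *: (a * b).
Proof. by rewrite scalerAl. Qed.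

Lemma malg_scalerAr c a b : a * (c *: b) = c *: (a * b).
Proof.
rewrite (malgMEw (fsubset_refl _) (msuppZ_le c b)) malgME scaler_sumr.
apply: eq_bigr => k1 _; rewrite scaler_sumr; apply: eq_bigr => k2 _.
by rewrite malgZU mcoeffZ mulrCA.
Qed.

Lemma prod_letter w : \prod_(x <- w) letter x = << FMonom w >> :> freealg K X.
Proof.
elim: w => [|x w IHw]; first by rewrite big_nil -fmoneE.
rewrite big_cons IHw /letter malgM_def fgmulUU mulr1; congr << _ *g _ >>.
by apply: val_inj; rewrite /= fmM fmU.
Qed.

Lemma linext_word (V : lmodType K) (f : seq X -> V) w :
  linext f (\prod_(x <- w) letter x) = f w.
Proof. by rewrite prod_letter /linext msuppU1 big_seq_fset1 mcoeffUU scale1r. Qed.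

Lemma word_span t : t = \sum_(w <- msupp t) t@_w *: \prod_(x <- w) letter x.
Proof.
rewrite {1}(monalgE t); apply: eq_bigr => w _.
by rewrite prod_letter fmK malgZU mulr1.
Qed.

End FreeAlgebraWords.

(** Linear maps out of a quotient of the free algebra are handled as functions on
words: the monomials [wmon w] span, so a linear map is known from its values on
them, and a function on words descends as soon as it respects the relations. *)
Section QuotientWords.
Variables (K : fieldType) (X : choiceType) (R : freealg K X -> Prop).
Local Notation A := (quotalg R).
Implicit Types (u v w : seq X) (s t : freealg K X) (a b : A).

Lemma qpiD : {morph \pi_A : s t / s + t}.
Proof. by move=> s t; rewrite !piE. Qed.
Lemma qpiM : {morph \pi_A : s t / s * t}.
Proof. by move=> s t; rewrite -[RHS]/(quotalg_mul _ _) !piE. Qed.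
Lemma qpiZ c : {morph \pi_A : t / c *: t}.
Proof. by move=> t; rewrite -[RHS]/(quotalg_scale _ _) !piE. Qed.
Lemma qpi_linear : linear \pi_A.
Proof. by move=> c s t; rewrite qpiD qpiZ. Qed.
Lemma qpi1 : \pi_A 1 = 1.
Proof. by rewrite -[RHS]/(quotalg_one _) !piE. Qed.

Lemma qscalerAl c a b : c *: (a * b) = c *: a * b.
Proof. by rewrite -[a]reprK -[b]reprK -!(qpiM, qpiZ) scalerAl. Qed.
Lemma qscalerAr c a b : c *: (a * b) = a * (c *: b).
Proof. by rewrite -[a]reprK -[b]reprK -!(qpiM, qpiZ) malg_scalerAr. Qed.

Definition wlet (x : X) : A := \pi_A (letter x).
Definition wmon w : A := \prod_(x <- w) wlet x.

Lemma wmon_pi w : wmon w = \pi_A (\prod_(x <- w) letter x).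
Proof. by rewrite (big_morph _ qpiM qpi1). Qed.

Lemma wmon_cons x w : wmon (x :: w) = wlet x * wmon w.
Proof. by rewrite /wmon big_cons. Qed.

Lemma quot_span a : exists s : seq (K * seq X), a = \sum_(p <- s) p.1 *: wmon p.2.
Proof.
exists [seq ((repr a)@_w, fmonom_val w) | w : {fmonom X} <- msupp (repr a)].
rewrite big_map -[LHS]reprK {1}(word_span (repr a)) (lin_sum qpi_linear) /=.
by apply: eq_bigr => w _; rewrite qpiZ wmon_pi.
Qed.

(** Induction on the number of terms of a linear combination of monomials. *)
Lemma quot_ind (P : A -> Prop) :
  P 0 -> (forall c w a, P a -> P (c *: wmon w + a)) -> forall a, P a.
Proof.
move=> P0 PS a; have [s ->] := quot_span a.
by elim: s => [|p s IHs]; rewrite ?big_nil // big_cons; apply: PS.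
Qed.

Lemma lin_eq (V : lmodType K) (f g : A -> V) : linear f -> linear g ->
  (forall w, f (wmon w) = g (wmon w)) -> f =1 g.
Proof.
move=> lf lg fg; apply: quot_ind => [|c w a IHa]; first by rewrite !lin0.
by rewrite lf lg fg IHa.
Qed.

(** By bilinearity the outer factors of an element of the ideal may be taken to be
words. *)
Lemma word_vanish (V : lmodType K) (f : seq X -> V) :
  (forall u v r, R r ->
    linext f ((\prod_(x <- u) letter x) * r * \prod_(x <- v) letter x) = 0) ->
  forall s r t, R r -> linext f (s * r * t) = 0.
Proof.
move=> fR s r t Rr; rewrite (word_span s) (word_span t) [_ * r]mulr_suml mulr_suml.
rewrite (lin_sum (linext_linear f)) big1 // => u _; rewrite mulr_sumr.
rewrite (lin_sum (linext_linear f)) big1 // => v _.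
by rewrite malg_scalerAr !malg_scalerAl !(linZ (linext_linear f)) fR // !scaler0.
Qed.

Section Quotext.
Variables (V : lmodType K) (f : seq X -> V).
Hypothesis fR : forall s r t, R r -> linext f (s * r * t) = 0.

Lemma quotext_mon w : quotext f (wmon w) = f w.
Proof. by rewrite wmon_pi quotext_pi // linext_word. Qed.

Lemma quotext_linear : linear (quotext f : A -> V).
Proof.
move=> c a b; rewrite -[a]reprK -[b]reprK -qpi_linear !quotext_pi //.
exact: linext_linear.
Qed.
End Quotext.

(** Both sides use the same representative of a, so this applies to a formula on
words before it is known to respect the relations. *)
Lemma quotext_comp (V W : lmodType K) (f : seq X -> V) (h : V -> W) (a : A) :
  linear h -> h (quotext f a) = quotext (h \o f) a.
Proof.
move=> lh; rewrite /quotext /linext (lin_sum lh).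
by apply: eq_bigr => w _; rewrite (linZ lh).
Qed.

End QuotientWords.

Arguments wlet {K X} R x.
Arguments wmon {K X} R w.

(** * Signs and homogeneous elements *)

Section KoszulSign.
Variable K : fieldType.
Implicit Types i j l : int.

Lemma ksignDl i j l : ksign (i + j) l = ksign i l * ksign j l :> K.
Proof. by rewrite /ksign mulrDl exprzDr // unitrN1. Qed.

Lemma ksignC i j : ksign i j = ksign j i :> K.
Proof. by rewrite /ksign mulrC. Qed.

Lemma ksignDr i j l : ksign i (j + l) = ksign i j * ksign i l :> K.
Proof. by rewrite ksignC ksignDl !(ksignC i). Qed.

Lemma ksignK i j : ksign i j * ksign i j = 1 :> K.
Proof. by rewrite /ksign -exprzMl ?unitrN1 // mulrNN mulr1 exp1rz. Qed.

Lemma ksignKC i j : ksign i j * ksign j i = 1 :> K.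
Proof. by rewrite (ksignC j) ksignK. Qed.

End KoszulSign.

Section HomogeneousElements.
Variables (K : fieldType) (V : gradedLmodType K).
Implicit Types (i j : int) (x y : V).

Lemma gpart0 i : gpart i (0 : V) = 0.
Proof. exact: (lin0 (@gpart_linear K V i)). Qed.

Lemma homog_gpartE i j x : homog i x -> gpart j x = if j == i then x else 0.
Proof. by move/eqP <-; rewrite gpartK. Qed.

Lemma homog0 i : homog i (0 : V).
Proof. by rewrite /homog gpart0. Qed.

Lemma homogD i x y : homog i x -> homog i y -> homog i (x + y).
Proof. by rewrite /homog (linD (@gpart_linear K V i)) => /eqP-> /eqP->. Qed.

Lemma homogZ i (a : K) x : homog i x -> homog i (a *: x).
Proof. by rewrite /homog (linZ (@gpart_linear K V i)) => /eqP->. Qed.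

Lemma homogB i x y : homog i x -> homog i y -> homog i (x - y).
Proof. by move=> hx hy; rewrite -scaleN1r homogD // homogZ. Qed.

Lemma homog_hval (x : hom_elt V) : homog (hdeg x) (hval x).
Proof. exact: valP x. Qed.

Lemma hpart_eq i x y : gpart i x = gpart i y -> hpart i x = hpart i y.
Proof. by move=> e; apply: val_inj; rewrite /= e. Qed.

Lemma hpart_gpart i x : hpart i (gpart i x) = hpart i x.
Proof. by apply: hpart_eq; rewrite gpartK eqxx. Qed.

Lemma hpart_hval (x : hom_elt V) : hpart (hdeg x) (hval x) = x.
Proof.
by case: x => [[i v] hv]; apply: val_inj; rewrite /= (eqP hv).
Qed.

Lemma hval_hpart i x : hval (hpart i x) = gpart i x.
Proof. by []. Qed.

Lemma hdeg_hpart i x : hdeg (hpart i x) = i.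
Proof. by []. Qed.

Lemma gsupp_uniq x : uniq (gsupp x).
Proof. by rewrite /gsupp; case/andP: (xchooseP (gpart_sum x)). Qed.

Lemma gsuppE x : x = \sum_(i <- gsupp x) gpart i x.
Proof. by rewrite {1}/gsupp; case/andP: (xchooseP (gpart_sum x)) => _ /eqP. Qed.

Lemma gsupp_out x i : i \notin gsupp x -> gpart i x = 0.
Proof.
move=> xi; rewrite (gsuppE x) (lin_sum (@gpart_linear K V i)) big_seq big1 // => j xj.
by rewrite gpartK; case: eqP => // e; rewrite e xj in xi.
Qed.

(** [gsupp x] is an arbitrary choice; any finite set of degrees that contains
the support of x gives the same sums. *)
Lemma gsupp_sum (W : zmodType) (F : int -> V -> W) x (s : seq int) :
    (forall i, F i 0 = 0) -> uniq s -> (forall i, i \notin s -> gpart i x = 0) ->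
  \sum_(i <- gsupp x) F i (gpart i x) = \sum_(i <- s) F i (gpart i x).
Proof.
move=> F0 us sx; pose t := undup (gsupp x ++ s).
have widen r : uniq r -> {subset r <= t} -> (forall i, i \notin r -> gpart i x = 0) ->
    \sum_(i <- r) F i (gpart i x) = \sum_(i <- t) F i (gpart i x).
  move=> ur rt rx; rewrite [RHS](bigID (mem r)) /= [X in _ + X]big1 ?addr0.
    rewrite -[RHS]big_filter; apply: perm_big; apply: uniq_perm => //.
      by rewrite filter_uniq // undup_uniq.
    by move=> i; rewrite mem_filter /=; case: (boolP (i \in r)) => // /rt ->.
  by move=> i /rx ->; rewrite F0.
rewrite !widen ?gsupp_uniq // => i; last exact: gsupp_out.
  by rewrite mem_undup mem_cat orbC => ->.
by rewrite mem_undup mem_cat => ->.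
Qed.

Lemma gsupp_homog (W : zmodType) (F : int -> V -> W) i x :
    (forall j, F j 0 = 0) -> homog i x ->
  \sum_(j <- gsupp x) F j (gpart j x) = F i x.
Proof.
move=> F0 hx; rewrite (@gsupp_sum _ F x [:: i]) // ?big_seq1 ?(eqP hx) // => j.
by rewrite inE (homog_gpartE _ hx) => /negPf->.
Qed.

Definition homlin (k : int) (f : V -> V) : Prop :=
  linear f /\ forall i x, homog i x -> homog (k + i) (f x).

Lemma homlin_gpart k f i x : homlin k f -> gpart (k + i) (f x) = f (gpart i x).
Proof.
move=> [lf hf]; rewrite {2}(gsuppE x) {1}(gsuppE x) (lin_sum lf).
rewrite !(lin_sum (@gpart_linear K V _)) (lin_sum lf); apply: eq_bigr => j _.
rewrite (homog_gpartE _ (hf _ _ (homog_gpart j x))) (inj_eq (addrI k)) gpartK.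
by case: eqP => // _; rewrite lin0.
Qed.

Definition hmap (k : int) (f : V -> V) (x : hom_elt V) : hom_elt V :=
  hpart (k + hdeg x) (f (hval x)).

Lemma hval_hmap k f (x : hom_elt V) : homlin k f -> hval (hmap k f x) = f (hval x).
Proof. by case=> _ hf; rewrite hval_hpart (eqP (hf _ _ (homog_hval x))). Qed.

Lemma hmap_hpart k f i x : homlin k f -> hmap k f (hpart i x) = hpart (k + i) (f x).
Proof. by move=> hf; apply: hpart_eq; rewrite !(homlin_gpart _ _ hf) gpartK eqxx. Qed.

End HomogeneousElements.

(** * Functions on words of homogeneous elements *)

Section WordFunctions.
Variables (K : fieldType) (L : gradedLmodType K) (V : lmodType K).
Local Notation X := (hom_elt L).
Implicit Types (u v w : seq X) (x y z : X) (g h : seq X -> V).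

Definition wlin g : Prop := forall u v i (a : K) (x y : L),
  g (u ++ hpart i (a *: x + y) :: v) =
    a *: g (u ++ hpart i x :: v) + g (u ++ hpart i y :: v).

(** The defining relation of the enveloping algebra with bracket e, read as a
condition on a function on words. The symmetric coalgebra is the case e = 0, so
that SL and UL can be treated together. *)
Definition wcomm (e : L -> L -> L) g : Prop := forall u v x y,
  g (u ++ x :: y :: v) = ksign (hdeg x) (hdeg y) *: g (u ++ y :: x :: v)
    + g (u ++ hpart (hdeg x + hdeg y) (e (hval x) (hval y)) :: v).

Lemma wlin_cons g x : wlin g -> wlin (fun v => g (x :: v)).
Proof. by move=> lg u v i a y z; apply: (lg (x :: u)). Qed.

Lemma wcomm_cons e g x : wcomm e g -> wcomm e (fun v => g (x :: v)).
Proof. by move=> cg u v y z; apply: (cg (x :: u)). Qed.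

Lemma wlin0 g u v i : wlin g -> g (u ++ hpart i 0 :: v) = 0.
Proof.
move=> lg; have := lg u v i 1 0 0; rewrite !scale1r addr0 => e.
by apply: (@addrI _ (g (u ++ hpart i 0 :: v))); rewrite -e addr0.
Qed.

Section Derivation.
Variables (k : int) (f : L -> L).

(** For g = [smonom] this is the value on w of the derivation of SL extending f.
Keeping g arbitrary makes induction on w possible and covers UL as well. *)
Fixpoint wderiv g w : V :=
  if w is x :: w' then
    g (hmap k f x :: w') + ksign k (hdeg x) *: wderiv (fun u => g (x :: u)) w'
  else 0.

Lemma wderiv_lin g h a w : wderiv (fun u => a *: g u + h u) w = a *: wderiv g w + wderiv h w.
Proof.
elim: w g h => [|x w IHw] g h /=; first by rewrite scaler0 addr0.
by rewrite IHw !scalerDr !scalerA [a * _]mulrC addrACA.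
Qed.

Lemma eq_wderiv g h w : (forall u, size u = size w -> g u = h u) -> wderiv g w = wderiv h w.
Proof.
elim: w g h => [|x w IHw] g h gh //=; rewrite gh // (IHw _ (fun u => h (x :: u))) //.
by move=> u su; apply: gh; rewrite /= su.
Qed.

Lemma wderiv_wlin g : homlin k f -> wlin g -> wlin (wderiv g).
Proof.
move=> hf lg u v i a x y; elim: u g lg => [|z u IHu] g lg /=.
  rewrite !hmap_hpart // (hf.1) (lg [::]) scalerDr scalerA mulrC -scalerA.
  rewrite addrACA -scalerDr !hdeg_hpart -wderiv_lin; congr (_ + _ *: _).
  by apply: eq_wderiv => v' _; apply: (lg [::]).
rewrite (lg (_ :: u)) (IHu _ (wlin_cons _ lg)) !scalerDr !scalerA [a * _]mulrC.
by rewrite addrACA.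
Qed.

(** A derivation of the bracket e extends to a derivation of the enveloping
algebra; for e = 0 every homogeneous linear map extends to SL. *)
Lemma wderiv_wcomm e g : homlin k f -> wlin g -> wcomm e g ->
    (forall x y, f (e (hval x) (hval y)) =
       e (f (hval x)) (hval y) + ksign k (hdeg x) *: e (hval x) (f (hval y))) ->
  wcomm e (wderiv g).
Proof.
move=> hf lg cg fe u v x y; elim: u g lg cg => [|z u IHu] g lg cg /=.
  rewrite hmap_hpart // fe addrC.
  set i := hdeg x; set j := hdeg y.
  rewrite hdeg_hpart.
  have -> : wderiv (fun u => g (x :: y :: u)) v =
      ksign i j *: wderiv (fun u => g (y :: x :: u)) v
      + wderiv (fun u => g (hpart (i + j) (e (hval x) (hval y)) :: u)) v.
    by rewrite -wderiv_lin; apply: eq_wderiv => v' _; apply: (cg [::]).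
  rewrite (cg [::] v (hmap k f x)) (cg [::] v x (hmap k f y)) !hval_hmap //.
  rewrite /hmap !hdeg_hpart -/i -/j.
  have -> : g (hpart (k + (i + j)) (e (f (hval x)) (hval y) +
      ksign k i *: e (hval x) (f (hval y))) :: v) =
      g (hpart (k + i + j) (e (f (hval x)) (hval y)) :: v) +
      ksign k i *: g (hpart (i + (k + j)) (e (hval x) (f (hval y))) :: v).
    rewrite [e _ _ + _]addrC [RHS]addrC [i + (k + j)]addrCA !addrA.
    exact: (lg [::]).
  move: (g (hpart (k + i + j) _ :: v)) (g (hpart (i + (k + j)) _ :: v)) => A B.
  rewrite !ksignDl !ksignDr !scalerDr !scalerA mulrA ksignKC mul1r.
  rewrite [LHS](AC ((2*2)*2) (1*(5*3)*((6*2)*4))) /=.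
  congr (_ + (_ *: _ + _ *: _) + _); first exact: mulrC.
  by rewrite mulrC (mulrC (ksign k i)) mulrA.
rewrite (cg (_ :: u)) (IHu _ (wlin_cons _ lg) (wcomm_cons _ cg)).
by rewrite !scalerDr !scalerA mulrC addrACA.
Qed.
End Derivation.

End WordFunctions.

(** * Signed sums over permutations of a word *)

Section Insertion.
Variables (K : fieldType) (L : gradedLmodType K) (V : lmodType K).
Local Notation X := (hom_elt L).
Implicit Types (u v w : seq X) (x y z : X) (g h : seq X -> V).

(** The signed shuffle product of the letter x with the word u, read through g.
Symmetrizing a word amounts to inserting its letters one after the other, which
reduces sums over permutations to inductions on words. *)
Fixpoint winsert x g u : V :=
  if u is y :: u' then
    g (x :: u) + ksign (hdeg x) (hdeg y) *: winsert x (fun v => g (y :: v)) u'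
  else g [:: x].

Lemma winsert_lin x g h a u :
  winsert x (fun v => a *: g v + h v) u = a *: winsert x g u + winsert x h u.
Proof.
elim: u g h => [|y u IHu] g h //=.
by rewrite IHu !scalerDr !scalerA [a * _]mulrC addrACA.
Qed.

Lemma eq_winsert x g h u :
  (forall v, size v = (size u).+1 -> g v = h v) -> winsert x g u = winsert x h u.
Proof.
elim: u g h => [|y u IHu] g h gh /=; first exact: gh.
rewrite gh // (IHu _ (fun v => h (y :: v))) // => v sv.
by apply: gh; rewrite /= sv.
Qed.

Lemma winsert_linl g u i (a : K) (x y : L) : wlin g ->
  winsert (hpart i (a *: x + y)) g u =
    a *: winsert (hpart i x) g u + winsert (hpart i y) g u.
Proof.
elim: u g => [|z u IHu] g lg /=; first exact: (lg [::]).
rewrite (lg [::]) IHu; last exact: wlin_cons.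
by rewrite !scalerDr !scalerA !hdeg_hpart [a * _]mulrC addrACA.
Qed.

Lemma winsert_wlin x g : wlin g -> wlin (winsert x g).
Proof.
move=> lg u v i a y z; elim: u g lg => [|t u IHu] g lg /=.
  rewrite (lg [:: x]) scalerDr !hdeg_hpart scalerA [a * _]mulrC -scalerA addrACA.
  rewrite -scalerDr -winsert_lin; congr (_ + _ *: _).
  by apply: eq_winsert => v' _; apply: (lg [::]).
rewrite (lg [:: x, t & u]) (IHu _ (wlin_cons _ lg)) !scalerDr !scalerA.
by rewrite [a * _]mulrC addrACA.
Qed.

(** The shuffle product is graded commutative. *)
Lemma winsert_comm x y g u :
  winsert x (winsert y g) u = ksign (hdeg x) (hdeg y) *: winsert y (winsert x g) u.
Proof.
elim: u g => [|z u IHu] g /=.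
  by rewrite scalerDr scalerA ksignK scale1r addrC (ksignC _ (hdeg y)).
rewrite -!(addrC (ksign (hdeg _) (hdeg z) *: winsert _ (fun v => g [:: _, z & v]) u)).
have lin t s : winsert t (fun v => g [:: s, z & v] +
      ksign (hdeg s) (hdeg z) *: winsert s (fun v' => g (z :: v')) v) u =
    ksign (hdeg s) (hdeg z) *: winsert t (winsert s (fun v' => g (z :: v'))) u
    + winsert t (fun v => g [:: s, z & v]) u.
  by rewrite -winsert_lin; apply: eq_winsert => v _; rewrite addrC.
rewrite !lin IHu !scalerDr !scalerA (ksignC _ (hdeg y) (hdeg x)) ksignK !mul1r scale1r.
rewrite [LHS](AC ((1*2)*2) (3*(5*1)*(4*2))) /=.
congr (_ + (_ + _) + (_ *: _ + _)).
by rewrite mulrC [X in _ * X]mulrC mulrA.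
Qed.

Section Derivation.
Variables (k : int) (f : L -> L).

(** A derivation of the concatenation product is one of the shuffle product. *)
Lemma winsert_wderiv x g u :
  winsert x (wderiv k f g) u =
    ksign k (hdeg x) *: wderiv k f (winsert x g) u + winsert (hmap k f x) g u.
Proof.
elim: u g => [|y u IHu] g /=; first by rewrite !scaler0 add0r addr0.
have lin h s : wderiv k f (fun v => g [:: x, y & v] + s *: h v) u =
    s *: wderiv k f h u + wderiv k f (fun v => g [:: x, y & v]) u.
  by rewrite -wderiv_lin; apply: eq_wderiv => v _; rewrite addrC.
have -> : winsert x (fun v => g (hmap k f y :: v) +
      ksign k (hdeg y) *: wderiv k f (fun u0 => g (y :: u0)) v) u =
    ksign k (hdeg y) *: winsert x (wderiv k f (fun u0 => g (y :: u0))) u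
    + winsert x (fun v => g (hmap k f y :: v)) u.
  by rewrite -winsert_lin; apply: eq_winsert => v _; rewrite addrC.
rewrite lin IHu !hdeg_hpart !ksignDl !ksignDr !scalerDr !scalerA !mulrA ksignKC mul1r.
rewrite [LHS](AC ((1*2)*(2*1)) (((2*6)*(4*3))*(1*5))) /=.
congr (_ + _ *: _ + (_ *: _ + _) + (_ + _ *: _)).
- by rewrite mulrC mulrA mulrAC.
- exact: mulrC.
Qed.
End Derivation.

End Insertion.

Section LiftPerm.

(** A permutation s of n.+1 points is the position j = s^-1 0 together with a
permutation of the remaining n points. *)
Lemma lift_perm0_bij n :
  bijective (fun p : 'I_n.+1 * 'S_n => lift_perm p.1 ord0 p.2).
Proof.
apply: inj_card_bij => [[i s] [j t] /= e|]; last first.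
  by rewrite card_prod card_ord !card_Sn factS.
have ij : i = j.
  by apply: (@perm_inj _ (lift_perm i ord0 s)); rewrite lift_perm_id e lift_perm_id.
rewrite -{j}ij in e *; congr (_, _); apply/permP => k.
by apply: (@lift_inj _ ord0); rewrite -!(lift_perm_lift i) e.
Qed.

Lemma sum_lift_perm n (V : nmodType) (P : pred 'S_n.+1) (F : 'S_n.+1 -> V) :
  \sum_(s | P s) F s =
  \sum_(j < n.+1) \sum_(s : 'S_n | P (lift_perm j ord0 s)) F (lift_perm j ord0 s).
Proof.
have [g gK Kg] := lift_perm0_bij n.
rewrite (reindex (fun p : 'I_n.+1 * 'S_n => lift_perm p.1 ord0 p.2)) /=; last first.
  by exists g => ? _.
by rewrite pair_big_dep.
Qed.

Lemma ltn_lift n (j : 'I_n.+1) (a b : 'I_n) : (lift j a < lift j b)%N = (a < b)%N.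
Proof. by rewrite !ltnNge leq_bump2. Qed.

Lemma ltn_lift_self n (j : 'I_n.+1) (a : 'I_n) : (lift j a < j)%N = (a < j)%N.
Proof. by rewrite ltnNge leq_bump /unbump ltnn subn0 -ltnNge. Qed.

Lemma unshuffleP n i (s : 'S_n) :
  reflect (forall a b : 'I_n, (a < b)%N -> (b < i)%N || (i <= a)%N -> (s a < s b)%N)
          (unshuffle i s).
Proof.
apply: (iffP forallP) => [h a b ab abi|h a].
  by have /forallP/(_ b)/implyP := h a; apply; rewrite ab.
by apply/forallP => b; apply/implyP => /andP[]; apply: h.
Qed.

(** The minimum of an unshuffle is the first entry of one of its two blocks. *)
Lemma unshuffle_lift_perm n i (j : 'I_n.+1) (s : 'S_n) :
  unshuffle i (lift_perm j ord0 s) =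
    if (j == 0 :> nat)%N then unshuffle i.-1 s else (j == i :> nat) && unshuffle i s.
Proof.
have lt0 a : (lift_perm j ord0 s j < lift_perm j ord0 s (lift j a))%N.
  by rewrite lift_perm_id lift_perm_lift.
have ltj0 b : (lift_perm j ord0 s b < lift_perm j ord0 s j)%N = false.
  by rewrite lift_perm_id.
have ltl a b : (lift_perm j ord0 s (lift j a) < lift_perm j ord0 s (lift j b))%N
    = (s a < s b)%N by rewrite !lift_perm_lift ltn_lift.
case: eqP => [j0|/eqP j0].
  have lj a : lift j a = a.+1 :> nat by rewrite /= j0.
  apply/unshuffleP/unshuffleP => h a b ab abi.
    rewrite -ltl; apply: h; rewrite !lj //.
    by case: i abi => [|i] //=; rewrite ltnS.
  move: ab abi; case: (unliftP j a) => [a' ->|->]; case: (unliftP j b) => [b' ->|->] //.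
  - by rewrite !lj ltl ltnS => ab abi; apply: h => //; case: i abi.
  - by rewrite j0.
  - by rewrite ltnn.
case: eqP => [ji|/eqP ji] /=.
  have lji a : (lift j a < i)%N = (a < i)%N.
    by rewrite -ji ltn_lift_self.
  have ilj a : (i <= lift j a)%N = (i <= a)%N by rewrite leqNgt lji -leqNgt.
  apply/unshuffleP/unshuffleP => h a b ab abi.
    by rewrite -ltl; apply: h; rewrite ?ltn_lift // lji ilj.
  move: ab abi; case: (unliftP j a) => [a' ->|->]; case: (unliftP j b) => [b' ->|->] //.
  - by rewrite lji ilj ltn_lift ltl => ab; apply: h.
  - by rewrite ji ltnn /= => ab /(leq_trans ab); rewrite ltnn.
  - by rewrite ltnn.
(* Otherwise the position just before j lies in the same block as j. *)
apply/negP => /unshuffleP h; have jn : (j.-1 < n.+1)%N by apply: leq_ltn_trans (leq_pred _) _.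
have := h (Ordinal jn) j; rewrite ltj0 /= prednK ?lt0n // leqnn => /(_ isT).
suff -> : (j < i)%N || (i <= j.-1)%N by move/(_ isT).
by case: ltngtP ji => //= ij _; rewrite -ltnS prednK ?lt0n.
Qed.

End LiftPerm.

Section SignedSums.
Variables (K : fieldType) (L : gradedLmodType K).
Local Notation X := (hom_elt L).
Implicit Types (u v w : seq X) (x y z : X).

Lemma size_permw w s : size (permw w s) = size w.
Proof. by rewrite size_map size_enum_ord. Qed.

Lemma nth_permw x0 w (s : 'S_(size w)) (i : 'I_(size w)) :
  nth x0 (permw w s) i = tnth (in_tuple w) (s i).
Proof. by rewrite (nth_map i) ?size_enum_ord // nth_ord_enum. Qed.

Lemma permw_lift x w (j : 'I_(size w).+1) (s : 'S_(size w)) :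
  permw (x :: w) (lift_perm j ord0 s) = take j (permw w s) ++ x :: drop j (permw w s).
Proof.
have jw : (j <= size w)%N by rewrite -ltnS.
apply: (@eq_from_nth _ x) => [|m].
  by rewrite size_permw size_cat /= addnS -size_cat cat_take_drop size_permw.
rewrite size_permw => mw; rewrite (@nth_permw x (x :: w) (lift_perm j ord0 s) (Ordinal mw)).
rewrite -[m in RHS]/(val (Ordinal mw)) nth_cat size_take size_permw.
have -> : (if (j < size w)%N then val j else size w) = j.
  by case: ltnP => // wj; apply/eqP; rewrite eqn_leq wj jw.
case: (unliftP j (Ordinal mw)) => [a ->|->]; last first.
  by rewrite lift_perm_id ltnn subnn.
rewrite lift_perm_lift (tnth_nth x) /= -/(permw w s).
have -> : nth x w (s a) = nth x (permw w s) a by rewrite nth_permw (tnth_nth x).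
rewrite /bump; case: (leqP j a) => ja; rewrite ?add0n ?add1n.
  by rewrite ltnNge leqW // subSn //= nth_drop subnKC.
by rewrite ja nth_take.
Qed.

Definition wsign x u : K := \prod_(y <- u) ksign (hdeg x) (hdeg y).

Lemma wsign_take x w (j : nat) (s : 'S_(size w)) : (j <= size w)%N ->
  wsign x (take j (permw w s)) =
  \prod_(i < size w | (i < j)%N) ksign (hdeg x) (hdeg (tnth (in_tuple w) (s i))).
Proof.
move=> jw; rewrite /wsign (big_nth x) size_take size_permw.
have -> : (if (j < size w)%N then j else size w) = j.
  by case: ltnP => // wj; apply/eqP; rewrite eqn_leq wj jw.
rewrite big_mkord (big_ord_narrow jw); apply: eq_bigr => i _.
by rewrite nth_take // -(nth_permw x).
Qed.

(** The inversions of s which are not inversions of the remaining permutation are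
the pairs formed by the first letter and the letters now standing before it. *)
Lemma koszul_lift x w (j : 'I_(size w).+1) (s : 'S_(size w)) :
  koszul (x :: w) (lift_perm j ord0 s) =
    wsign x (take j (permw w s)) * koszul w s.
Proof.
have jw : (j <= size w)%N by rewrite -ltnS.
rewrite wsign_take // /koszul (bigD1_ord j) //= big1 ?mul1r; last first.
  by move=> b; rewrite lift_perm_id ltn0 andbF.
rewrite [X in _ = X * _]big_mkcond -big_split /=; apply: eq_bigr => a _.
rewrite !lift_perm_lift.
rewrite big_mkcond (bigD1_ord j) // lift_perm_id ltn_lift_self.
have tnthS b : tnth (in_tuple (x :: w)) (lift ord0 b) = tnth (in_tuple w) b.
  by rewrite !(tnth_nth x).
congr (_ * _); first by rewrite tnthS (tnth_nth x) /= andbT ksignC.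
rewrite [RHS]big_mkcond; apply: eq_bigr => b _.
by rewrite lift_perm_lift !ltn_lift !tnthS.
Qed.

Definition wunshuffle (V : lmodType K) (i : nat) (g : seq X -> V) w : V :=
  \sum_(s : 'S_(size w) | unshuffle i s) koszul w s *: g (permw w s).

Definition wsymm (V : lmodType K) (g : seq X -> V) w : V :=
  \sum_(s : 'S_(size w)) koszul w s *: g (permw w s).

Lemma koszul_nil (s : 'S_(size [::])) : koszul (L := L) [::] s = 1.
Proof. by rewrite /koszul big_ord0. Qed.

Lemma permw_nil (s : 'S_(size [::])) : permw (L := L) [::] s = [::].
Proof. by apply/size0nil; rewrite size_permw. Qed.

Lemma big_S0 (V : nmodType) (P : pred 'S_0) (F : 'S_0 -> V) :
  P 1%g -> \sum_(s | P s) F s = F 1%g.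
Proof.
move=> P1; rewrite (big_pred1 (1%g : 'S_0)) // => s /=.
suff -> : s = 1%g by rewrite P1 eqxx.
by apply/permP => - [].
Qed.

Section Values.
Variable V : lmodType K.
Implicit Types g h : seq X -> V.

Lemma winsert_sum x g u :
  winsert x g u = \sum_(j < (size u).+1) wsign x (take j u) *: g (take j u ++ x :: drop j u).
Proof.
elim: u g => [|y u IHu] g /=.
  by rewrite big_ord_recl big_ord0 addr0 /wsign big_nil scale1r.
rewrite big_ord_recl /wsign /= big_nil scale1r IHu scaler_sumr; congr (_ + _).
by apply: eq_bigr => j _; rewrite /= big_cons scalerA.
Qed.

Lemma wsymm_nil g : wsymm g [::] = g [::].
Proof. by rewrite /wsymm big_S0 // koszul_nil permw_nil scale1r. Qed.

Lemma wsymm_cons x g w : wsymm g (x :: w) = wsymm (winsert x g) w.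
Proof.
rewrite /wsymm sum_lift_perm exchange_big; apply: eq_bigr => s _ /=.
rewrite winsert_sum scaler_sumr size_permw; apply: eq_bigr => j _.
by rewrite koszul_lift permw_lift scalerA mulrC.
Qed.

Lemma wunshuffle_nil i g : wunshuffle i g [::] = g [::].
Proof.
rewrite /wunshuffle big_S0 ?koszul_nil ?permw_nil ?scale1r //.
by apply/unshuffleP => - [].
Qed.

(** The first letter of the word is the minimum, so it starts one of the two
blocks; this is the Pascal recursion for unshuffles. *)
Lemma wunshuffle_cons i x g w : wunshuffle i g (x :: w) =
  wunshuffle i.-1 (fun u => g (x :: u)) w +
  (if (0 < i <= size w)%N
   then wunshuffle i (fun u => wsign x (take i u) *: g (take i u ++ x :: drop i u)) w
   else 0).
Proof.
rewrite /wunshuffle sum_lift_perm big_ord_recl; congr (_ + _).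
  apply: eq_big => s; first by rewrite unshuffle_lift_perm.
  by rewrite koszul_lift permw_lift /wsign take0 drop0 big_nil mul1r.
case: ifP => [/andP[i0 iw]|iF]; last first.
  apply: big1 => j _; apply: big1 => s; rewrite unshuffle_lift_perm /=.
  by case/andP => /eqP ji; rewrite -ji ltn_ord in iF.
case: i i0 iw => // i _ iw.
rewrite (bigD1 (Ordinal iw)) //= [X in _ + X]big1 ?addr0; last first.
  move=> j ji; apply: big1 => s; rewrite unshuffle_lift_perm /=.
  case/andP => /eqP [ij]; case/eqP: ji; exact: val_inj.
apply: eq_big => s; first by rewrite unshuffle_lift_perm /= eqxx.
by rewrite koszul_lift permw_lift /= scalerA mulrC.
Qed.

Lemma wunshuffle_id i g w : (i == 0)%N || (size w <= i)%N -> wunshuffle i g w = g w.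
Proof.
elim: w i g => [|x w IHw] i g iw; first exact: wunshuffle_nil.
rewrite wunshuffle_cons IHw; last by case: i iw => //= i; rewrite ltnS => ->; rewrite orbT.
case: ifP => [/andP[i0 iw']|]; last by rewrite addr0.
by move: iw; rewrite /= leqNgt ltnS iw' orbF eqn0Ngt i0.
Qed.

Lemma wsymm_lin a g h w : wsymm (fun u => a *: g u + h u) w = a *: wsymm g w + wsymm h w.
Proof.
rewrite /wsymm scaler_sumr -big_split /=; apply: eq_bigr => s _.
by rewrite scalerDr !scalerA mulrC.
Qed.

Lemma eq_wsymm g h w :
  (forall u, size u = size w -> g u = h u) -> wsymm g w = wsymm h w.
Proof. by move=> gh; apply: eq_bigr => s _; rewrite gh ?size_permw. Qed.

Lemma wsymm_wlin g : wlin g -> wlin (wsymm g).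
Proof.
move=> lg u v i a x y; elim: u g lg => [|z u IHu] g lg /=.
  rewrite !wsymm_cons -wsymm_lin; apply: eq_wsymm => v' _.
  exact: winsert_linl.
by rewrite !wsymm_cons IHu //; apply: winsert_wlin.
Qed.

(** Symmetrization makes any multilinear function graded symmetric. *)
Lemma wsymm_wcomm g : wlin g -> wcomm (fun _ _ => 0) (wsymm g).
Proof.
move=> lg u v x y; rewrite (wlin0 _ _ _ (wsymm_wlin lg)) addr0 => {lg}.
elim: u g => [|z u IHu] g /=; last by rewrite !wsymm_cons.
rewrite !wsymm_cons; rewrite -[RHS]addr0 -[0](_ : wsymm (fun=> 0 : V) v = 0).
  rewrite -wsymm_lin; apply: eq_wsymm => v' _.
  by rewrite addr0 winsert_comm ksignC.
by rewrite /wsymm big1 // => s _; rewrite scaler0.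
Qed.

Section Derivation.
Variables (k : int) (f : L -> L).

(** The letters are inserted one at a time, each as in [winsert_wderiv]. Hence the
derivations of SL and UL induced by one map correspond under symmetrization. *)
Lemma wsymm_wderiv g w : wderiv k f (wsymm g) w = wsymm (wderiv k f g) w.
Proof.
elim: w g => [|x w IHw] g; first by rewrite /= wsymm_nil.
rewrite /= !wsymm_cons.
have -> : wderiv k f (fun u => wsymm g (x :: u)) w = wderiv k f (wsymm (winsert x g)) w.
  by apply: eq_wderiv => u _; rewrite wsymm_cons.
rewrite IHw addrC -wsymm_lin; apply: eq_wsymm => u _.
by rewrite winsert_wderiv.
Qed.

(** An unshuffle with first block of length one moves a letter to the front; when
g is graded symmetric the letter can be moved back after f has been applied, and
the sign left over is that of f passing the letters before it. *)
Lemma wunshuffle1_wderiv g w : wlin g -> wcomm (fun _ _ => 0) g ->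
  wunshuffle 1 (fun u => if u is y :: u' then g (hmap k f y :: u') else 0) w = wderiv k f g w.
Proof.
elim: w g => [|x w IHw] g lg cg; first by rewrite wunshuffle_nil.
rewrite wunshuffle_cons wunshuffle_id //=; congr (_ + _); case: w IHw => [|z w] IHw.
  by rewrite /= scaler0.
rewrite -IHw; [|exact: wlin_cons|exact: wcomm_cons].
rewrite /= /wunshuffle scaler_sumr -!/(wunshuffle _ _ (z :: w)); apply: eq_bigr => s _.
have := size_permw s; case: (permw _ s) => // y u _ /=.
rewrite take0 drop0 /wsign big_seq1 (cg [::] _ x) (wlin0 [::]) // addr0 !scalerA.
by rewrite hdeg_hpart ksignDr mulrACA ksignKC mul1r.
Qed.

End Derivation.
End Values.
End SignedSums.

Lemma wderiv_map (K : fieldType) (L : gradedLmodType K) (V W : lmodType K)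
    k f (h : V -> W) (g : seq (hom_elt L) -> V) w :
  linear h -> wderiv k f (fun u => h (g u)) w = h (wderiv k f g w).
Proof.
move=> lh; elim: w g => [|x w IHw] g /=; first by rewrite lin0.
by rewrite (IHw (fun u => g (x :: u))) -linZ // -linD.
Qed.

Section RelationsInContext.
Variables (K : fieldType) (X : choiceType).
Implicit Types (u v w : seq X).

Lemma qpi_rel (R : freealg K X -> Prop) r : R r -> \pi_(quotalg R) r = 0.
Proof.
move=> Rr; rewrite -(lin0 (@qpi_linear K X R)); apply/quotalg_eqP.
by rewrite subr0; apply/idealP; rewrite -[r]mul1r -[1 * r]mulr1; apply: IdealM.
Qed.

Lemma prod_cat2 (A : pzRingType) (F : X -> A) u x y v :
  \prod_(z <- u ++ x :: y :: v) F z =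
    (\prod_(z <- u) F z) * (F x * F y) * \prod_(z <- v) F z.
Proof. by rewrite big_cat !big_cons /= !mulrA. Qed.

Lemma prod_cat1 (A : pzRingType) (F : X -> A) u x v :
  \prod_(z <- u ++ x :: v) F z = (\prod_(z <- u) F z) * F x * \prod_(z <- v) F z.
Proof. by rewrite big_cat !big_cons /= !mulrA. Qed.

Definition linctx (V : lmodType K) (g : seq X -> V) u v (t : freealg K X) : V :=
  linext g ((\prod_(y <- u) letter y) * t * \prod_(y <- v) letter y).

Lemma linctx_linear (V : lmodType K) (g : seq X -> V) u v : linear (linctx g u v).
Proof.
move=> c s t; rewrite /linctx mulrDr mulrDl malg_scalerAr malg_scalerAl.
exact: linext_linear.
Qed.

Lemma linctx_letter (V : lmodType K) (g : seq X -> V) u x v :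
  linctx g u v (letter x) = g (u ++ x :: v).
Proof. by rewrite -(linext_word g) prod_cat1. Qed.

Lemma linctx_letter2 (V : lmodType K) (g : seq X -> V) u x y v :
  linctx g u v (letter x * letter y) = g (u ++ x :: y :: v).
Proof. by rewrite -(linext_word g) prod_cat2. Qed.

Lemma linctx_comm (V : lmodType K) (g : seq X -> V) u x y (c : K) v :
  linctx g u v (letter x * letter y - c *: (letter y * letter x)) =
    g (u ++ x :: y :: v) - c *: g (u ++ y :: x :: v).
Proof.
rewrite (linB (linctx_linear g u v)); congr (_ - _); first exact: linctx_letter2.
rewrite (linZ (linctx_linear g u v)); congr (_ *: _); exact: linctx_letter2.
Qed.

Lemma qpi_comm (R : freealg K X -> Prop) x y (c : K) :
  \pi_(quotalg R) (letter x * letter y - c *: (letter y * letter x)) =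
    wlet R x * wlet R y - c *: (wlet R y * wlet R x).
Proof.
rewrite (linB (@qpi_linear K X R)); congr (_ - _); first exact: qpiM.
by rewrite qpiZ; congr (_ *: _); exact: qpiM.
Qed.

End RelationsInContext.

Lemma qderM (K : fieldType) (L : gradedLmodType K)
    (R : freealg K (hom_elt L) -> Prop) k f (D := quotext (wderiv k f (wmon R)))
    x (a : quotalg R) :
    (forall s r t, R r -> linext (wderiv k f (wmon R)) (s * r * t) = 0) ->
  D (wlet R x * a) =
    wlet R (hmap k f x) * a + ksign k (hdeg x) *: (wlet R x * D a).
Proof.
move=> fR; have ll : linear D by apply: quotext_linear.
have lin y : linear (fun b : quotalg R => wlet R y * b).
  by move=> c b b'; rewrite mulrDr qscalerAr.
move: a; apply: (@lin_eq _ _ R _ (fun a => D (wlet R x * a))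
  (fun a => wlet R (hmap k f x) * a + ksign k (hdeg x) *: (wlet R x * D a)))
  => [c a b|c a b|w].
- by rewrite lin ll.
- by rewrite ll 2!lin !scalerDr !scalerA mulrC addrACA.
rewrite /D -wmon_cons !quotext_mon //= wmon_cons; congr (_ + _ *: _).
rewrite -(wderiv_map k f (wmon R) w (lin x)).
by apply: eq_wderiv => u _; rewrite wmon_cons.
Qed.

(** * The symmetric coalgebra *)

Section SymmetricCoalgebra.
Variables (K : fieldType) (L : gradedLmodType K).
Local Notation X := (hom_elt L).
Local Notation SL := (SymCoalg L).
Implicit Types (u v w : seq X) (x y z : X) (a b : SL).

Lemma sym_scalerAl c a b : c *: a * b = c *: (a * b).
Proof. by rewrite [RHS]qscalerAl. Qed.

Lemma sym_scalerAr c a b : a * (c *: b) = c *: (a * b).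
Proof. by rewrite [RHS]qscalerAr. Qed.

Lemma smonom_nil : smonom [::] = 1 :> SL.
Proof. by rewrite /smonom big_nil. Qed.

Lemma smonom_cons x w : smonom (x :: w) = sletter x * smonom w.
Proof. by rewrite /smonom big_cons. Qed.

Lemma smonom_cat u v : smonom (u ++ v) = smonom u * smonom v.
Proof. by rewrite /smonom big_cat. Qed.

Lemma smonom1 x : smonom [:: x] = sletter x.
Proof. by rewrite smonom_cons smonom_nil mulr1. Qed.

Lemma sym_ind (P : SL -> Prop) : P 0 ->
  (forall c w a, P a -> P (c *: smonom w + a)) -> forall a, P a.
Proof. exact: quot_ind. Qed.

Lemma sym_lin_eq (V : lmodType K) (f g : SL -> V) : linear f -> linear g ->
  (forall w, f (smonom w) = g (smonom w)) -> f =1 g.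
Proof. exact: lin_eq. Qed.

Lemma sym_vanish (V : lmodType K) (g : seq X -> V) :
    wlin g -> wcomm (fun _ _ => 0) g ->
  forall s r t, @sym_rel K L r -> linext g (s * r * t) = 0.
Proof.
move=> lg cg; apply: word_vanish => u v r rr; rewrite -/(linctx g u v r).
have ll := linctx_linear g u v.
case: rr => [i c x y|x y].
  by rewrite 2!(linB ll) [X in _ - X - _](linZ ll) 3!linctx_letter lg -addrA -opprD subrr.
by rewrite linctx_comm cg wlin0 // addr0 subrr.
Qed.

Section Extension.
Variables (V : lmodType K) (g : seq X -> V).
Hypotheses (lg : wlin g) (cg : wcomm (fun _ _ => 0) g).

Lemma symext_mon w : quotext g (smonom w) = g w.
Proof. exact: quotext_mon (sym_vanish lg cg) w. Qed.

Lemma symext_linear : linear (quotext g : SL -> V).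
Proof. exact: quotext_linear (sym_vanish lg cg). Qed.
End Extension.

Lemma sletter_linear i : linear (fun x : L => sletter (hpart i x)).
Proof.
move=> c x y; apply/eqP; rewrite -subr_eq0 opprD addrA; apply/eqP.
have := qpi_rel (SymLinear i c x y).
have ll := @qpi_linear K X (@sym_rel K L).
by rewrite 2!(linB ll) [X in _ - X - _](linZ ll).
Qed.

Lemma sletterC x y :
  sletter x * sletter y = ksign (hdeg x) (hdeg y) *: (sletter y * sletter x).
Proof.
apply/eqP; rewrite -subr_eq0; apply/eqP.
by have := qpi_rel (SymComm x y); rewrite qpi_comm.
Qed.

Lemma smonom_wlin : wlin (@smonom K L).
Proof.
move=> u v i c x y; rewrite !smonom_cat !smonom_cons sletter_linear.
by rewrite mulrDl mulrDr sym_scalerAl sym_scalerAr.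
Qed.

Lemma smonom_wcomm : wcomm (fun _ _ => 0) (@smonom K L).
Proof.
move=> u v x y; rewrite (wlin0 _ _ _ smonom_wlin) addr0 !smonom_cat !smonom_cons.
by rewrite [sletter x * (_ * _)]mulrA sletterC sym_scalerAl sym_scalerAr -mulrA.
Qed.

(** ** The inclusion of L, the projection to L and the word length *)

Lemma siota_linear : linear (@siota K L).
Proof.
move=> c x y; have s0 (i : int) : sletter (hpart i (0 : L)) = 0.
  exact: (lin0 (sletter_linear i)).
pose s := undup (gsupp x ++ gsupp y ++ gsupp (c *: x + y)).
have siotaE (z : L) : {subset gsupp z <= s} -> siota z = \sum_(i <- s) sletter (hpart i z).
  move=> zs; rewrite /siota.
  under eq_bigr do rewrite -hpart_gpart.
  rewrite (@gsupp_sum K L _ (fun i (t : L) => sletter (hpart i t)) z s) ?undup_uniq //.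
    by apply: eq_bigr => i _; rewrite hpart_gpart.
  by move=> i si; apply: gsupp_out; apply: contra si; apply: zs.
rewrite !siotaE; try (by move=> i; rewrite mem_undup !mem_cat => ->; rewrite ?orbT).
by rewrite scaler_sumr -big_split; apply: eq_bigr => i _; rewrite sletter_linear.
Qed.

Lemma siota_homog i (x : L) : homog i x -> siota x = sletter (hpart i x).
Proof.
move=> hx; rewrite /siota; under eq_bigr do rewrite -hpart_gpart.
rewrite (@gsupp_homog K L _ (fun i (t : L) => sletter (hpart i t)) i) // => j.
exact: (lin0 (sletter_linear j)).
Qed.

Lemma siota_hval x : siota (hval x) = sletter x.
Proof. by rewrite (siota_homog (homog_hval x)) hpart_hval. Qed.

Definition wproj w : L := if w is [:: x] then hval x else 0.

Lemma wproj_wlin : wlin wproj.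
Proof.
by case=> [|z [|t u]] [|s v] i c x y; rewrite /= ?scaler0 ?addr0 // !hval_hpart gpart_linear.
Qed.

Lemma wproj_wcomm : wcomm (fun _ _ => 0) wproj.
Proof.
move=> u v x y; rewrite (wlin0 _ _ _ wproj_wlin) addr0.
by case: u => [|z [|t u]]; rewrite /= scaler0.
Qed.

Lemma sproj_linear : linear (@sproj K L).
Proof. exact: (symext_linear wproj_wlin wproj_wcomm). Qed.

Lemma sproj_mon w : sproj (smonom w) = if w is [:: x] then hval x else 0.
Proof. exact: (symext_mon wproj_wlin wproj_wcomm). Qed.

Lemma sproj_siotaM (l : L) w :
  sproj (siota l * smonom w) = if w is [::] then l else 0.
Proof.
rewrite /siota mulr_suml (lin_sum sproj_linear).
under eq_bigr do rewrite -smonom_cons sproj_mon.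
by case: w => [|z w]; [rewrite [RHS](gsuppE l)|rewrite big1].
Qed.

Definition wpart n w : SL := if size w == n then smonom w else 0.

Lemma wpart_wlin n : wlin (wpart n).
Proof.
move=> u v i c x y; rewrite /wpart !size_cat /=.
by case: eqP => _; rewrite ?scaler0 ?addr0 // smonom_wlin.
Qed.

Lemma wpart_wcomm n : wcomm (fun _ _ => 0) (wpart n).
Proof.
move=> u v x y; rewrite (wlin0 _ _ _ (wpart_wlin n)) addr0 /wpart !size_cat /=.
by case: eqP => _; rewrite ?scaler0 // smonom_wcomm (wlin0 _ _ _ smonom_wlin) addr0.
Qed.

Lemma sympart_linear n : linear (@sympart K L n).
Proof. exact: (symext_linear (wpart_wlin n) (wpart_wcomm n)). Qed.

Lemma sympart_mon n w : sympart n (smonom w) = if size w == n then smonom w else 0.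
Proof. exact: (symext_mon (wpart_wlin n) (wpart_wcomm n)). Qed.

Lemma sympart_id n a : sympart n (sympart n a) = sympart n a.
Proof.
have lin := sympart_linear n.
move: a; apply: (@sym_lin_eq _ (sympart n \o sympart n) (sympart n)) => [c a b| |w] /=.
- by rewrite 2!lin.
- exact: lin.
rewrite sympart_mon; case: eqP => [/eqP sw|_]; last by rewrite (lin0 lin).
by rewrite sympart_mon sw.
Qed.

(** ** Coderivations with a single Taylor coefficient *)

(** All terms of the coderivation formula have at least two letters, except the
one with an empty second block. *)
Lemma sproj_coder1 n (q : SL -> L) a :
  linear q -> sproj (coder1 n q a) = q (sympart n a).
Proof.
move=> lq; rewrite /coder1 /coder (quotext_comp _ _ sproj_linear).
rewrite /sympart (quotext_comp _ _ lq); congr (quotext _ a); apply: funext => w /=.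
rewrite (lin_sum sproj_linear) big_ord_recr /= big1 ?add0r => [|i _].
  rewrite (lin_sum sproj_linear).
  under eq_bigr do rewrite (linZ sproj_linear).
  rewrite -/(wunshuffle (size w) (fun u => sproj (siota ((if size w == n then q else fun=> 0)
    (smonom (take (size w) u))) * smonom (drop (size w) u))) w).
  rewrite wunshuffle_id ?leqnn ?orbT // take_size drop_size sproj_siotaM.
  by case: eqP => // _; rewrite (lin0 lq).
rewrite (lin_sum sproj_linear) big1 // => s _; rewrite (linZ sproj_linear) sproj_siotaM.
have : size (drop i (permw w s)) != 0%N by rewrite size_drop size_permw subn_eq0 -ltnNge.
by case: drop => // y u _; rewrite scaler0.
Qed.

Lemma sproj_lincoder (f : L -> L) a : linear f -> sproj (lincoder f a) = f (sproj a).
Proof.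
move=> lf; rewrite sproj_coder1; last by move=> c x y /=; rewrite sproj_linear lf.
have lin := sympart_linear 1.
suff h : (f \o @sproj K L \o sympart 1) =1 (f \o @sproj K L) by exact: h.
apply: (@sym_lin_eq L) => [c b b'|c b b'|w] /=.
- by rewrite lin sproj_linear lf.
- by rewrite sproj_linear lf.
rewrite sympart_mon sproj_mon.
by case: w => [|x [|y w]]; rewrite ?(lin0 sproj_linear) ?sproj_mon.
Qed.

Lemma smonom_cons_prod x w :
  smonom (x :: w) =
    siota (hval x) * \prod_(j < size w) siota (hval (tnth (in_tuple w) j)).
Proof.
rewrite smonom_cons siota_hval; congr (_ * _); rewrite /smonom big_tnth.
by apply: eq_bigr => j _; rewrite siota_hval.
Qed.

Section HomogeneousLinear.
Variables (k : int) (f : L -> L).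
Hypothesis hf : homlin k f.

Let f0_wcomm : forall x y : X, f 0 = 0 + ksign k (hdeg x) *: 0.
Proof. by move=> x y; rewrite scaler0 addr0 (lin0 hf.1). Qed.

Let wlin_f := wderiv_wlin hf smonom_wlin.
Let wcomm_f := wderiv_wcomm hf smonom_wlin smonom_wcomm f0_wcomm.

(** A linear coderivation of SL is also a derivation of its product. *)
Lemma lincoderE : lincoder f = quotext (wderiv k f (@smonom K L)).
Proof.
rewrite /lincoder /coder1 /coder; congr (quotext _); apply: funext => w.
rewrite -(wunshuffle1_wderiv k f _ smonom_wlin smonom_wcomm).
case: w => [|x w].
  rewrite big_ord_recl big_ord0 addr0 wunshuffle_nil big1 // => s _ /=.
  by rewrite (lin0 siota_linear) mul0r scaler0.
rewrite 2!big_ord_recl [in X in X + _]big1 ?add0r => [|s _]; last first.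
  by rewrite /= (lin0 siota_linear) mul0r scaler0.
rewrite [X in _ + X]big1 ?addr0 => [|i _]; last first.
  have -> : (lift ord0 (lift ord0 i) == 1%N :> nat) = false by [].
  by rewrite big1 // => s _; rewrite (lin0 siota_linear) mul0r scaler0.
apply: eq_bigr => s _; have := size_permw s; case: (permw _ s) => // y u _.
by rewrite /= take0 drop0 sproj_mon smonom_cons -siota_hval hval_hmap.
Qed.

Lemma lincoder_linear : linear (lincoder f).
Proof. by rewrite lincoderE; apply: symext_linear. Qed.

Lemma lincoder_mon w : lincoder f (smonom w) = wderiv k f (@smonom K L) w.
Proof. by rewrite lincoderE symext_mon. Qed.

Lemma lincoder1 : lincoder f 1 = 0.
Proof. by rewrite -smonom_nil lincoder_mon. Qed.

Lemma lincoderM x a : lincoder f (sletter x * a) =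
  sletter (hmap k f x) * a + ksign k (hdeg x) *: (sletter x * lincoder f a).
Proof.
by rewrite lincoderE; apply: qderM; exact: sym_vanish wlin_f wcomm_f.
Qed.

End HomogeneousLinear.
End SymmetricCoalgebra.

(** * The filtration by word length *)

Section LengthFiltration.
Variables (K : fieldType) (X : Type) (V : lmodType K) (m : seq X -> V).
Implicit Types (u v w : seq X) (a b : V).

Inductive low (n : nat) : V -> Prop :=
| low0 : low n 0
| lowS (c : K) w a : (size w < n)%N -> low n a -> low n (c *: m w + a).

Lemma low_word n w : (size w < n)%N -> low n (m w).
Proof. by move=> sw; rewrite -[m w]addr0 -[m w]scale1r; apply/lowS/low0. Qed.

Lemma lowD n a b : low n a -> low n b -> low n (a + b).
Proof.
elim=> [|c w a' sw _ IH] lb; first by rewrite add0r.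
by rewrite -addrA; apply: lowS => //; apply: IH.
Qed.

Lemma lowZ n (c : K) a : low n a -> low n (c *: a).
Proof.
elim=> [|c' w a' sw _ IH]; first by rewrite scaler0; apply: low0.
by rewrite scalerDr scalerA; apply: lowS.
Qed.

Lemma lowB n a b : low n a -> low n b -> low n (a - b).
Proof. by move=> la lb; rewrite -scaleN1r; apply/lowD/lowZ. Qed.

Lemma low_sum n (I : Type) (r : seq I) (P : pred I) (F : I -> V) :
  (forall i, P i -> low n (F i)) -> low n (\sum_(i <- r | P i) F i).
Proof. by move=> lF; apply: big_ind => //; [apply: low0|apply: lowD]. Qed.

Lemma lowW n n' a : (n <= n')%N -> low n a -> low n' a.
Proof.
move=> nn'; elim=> [|c w b sw _ IH]; first exact: low0.
by apply: lowS => //; apply: leq_trans nn'.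
Qed.

Lemma low_eq0 a : low 0 a -> a = 0.
Proof. by case. Qed.

(** An endomorphism which is the identity modulo shorter words is bijective: on
the words of length at most n the difference to the identity is nilpotent. *)
Section Unipotent.
Variable f : V -> V.
Hypotheses (lin_f : linear f) (f_low : forall w, low (size w) (f (m w) - m w)).

Lemma unip_low n a : low n.+1 a -> low n (f a - a).
Proof.
elim=> [|c w b sw _ IH]; first by rewrite (lin0 lin_f) subrr; apply: low0.
rewrite lin_f opprD addrACA -scalerBr; apply: lowD => //; apply: lowZ.
by apply: lowW (f_low w); rewrite -ltnS.
Qed.

Lemma unip_inj n a : low n a -> f a = 0 -> a = 0.
Proof.
elim: n a => [|n IHn] a; first by move/low_eq0.
move=> /unip_low fa fa0; apply: IHn => //.
by rewrite -[a]opprK -scaleN1r; apply: lowZ; rewrite fa0 sub0r in fa.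
Qed.

Lemma unip_surj n a : low n a -> exists b, f b = a.
Proof.
elim: n a => [|n IHn] a; first by move/low_eq0->; exists 0; apply: lin0.
move=> /unip_low fa.
have /IHn[b fb] : low n (a - f a) by rewrite -opprB -scaleN1r; apply: lowZ.
by exists (b + a); rewrite (linD lin_f) fb subrK.
Qed.
End Unipotent.

End LengthFiltration.

Lemma low_map (K : fieldType) (X Y : Type) (V W : lmodType K)
    (m : seq X -> V) (m' : seq Y -> W) (h : V -> W) n n' a :
  linear h -> (forall w, (size w < n)%N -> low m' n' (h (m w))) ->
  low m n a -> low m' n' (h a).
Proof.
move=> lh hm; elim=> [|c w b sw _ IH]; first by rewrite (lin0 lh); apply: low0.
by rewrite lh; apply: lowD => //; apply: lowZ; apply: hm.
Qed.

Section LowSymmetrization.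
Variables (K : fieldType) (L : gradedLmodType K) (V : lmodType K).
Local Notation X := (hom_elt L).
Variables (e : L -> L -> L) (m : seq X -> V).
Hypothesis cm : wcomm e m.
Implicit Types (p u w : seq X) (x y : X).

(** Modulo shorter words the letters of a word commute up to sign, so that the
place where a letter is inserted is irrelevant. *)
Lemma winsert_low p x u :
  low m (size p + size u).+1
    (winsert x (fun v => m (p ++ v)) u - (size u).+1%:R *: m (p ++ x :: u)).
Proof.
elim: u p => [|y u IHu] p /=; first by rewrite scale1r subrr; apply: low0.
set s := ksign _ _; have -> : (size u).+2%:R = (size u).+1%:R + 1 :> K by rewrite natr1.
move: (IHu (rcons p y)); move: (size u).+1%:R => n {}IHu.
have -> : winsert x (fun v => m (p ++ y :: v)) u =
    (winsert x (fun v => m (rcons p y ++ v)) u - n *: m (rcons p y ++ x :: u))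
    + n *: m (p ++ y :: x :: u).
  by rewrite cat_rcons subrK; apply: eq_winsert => v _; rewrite cat_rcons.
have -> (A B C : V) : A + s *: (B + n *: C) - (n + 1) *: A =
    s *: B - n *: (A - s *: C).
  rewrite scalerDl scale1r scalerDr scalerBr !scalerA [n * s]mulrC.
  rewrite opprB opprD [LHS](AC ((1*2)*2) ((2*(3*4))*(1*5))) /=.
  by rewrite subrr addr0.
apply: lowB; apply: lowZ.
  by move: IHu; rewrite size_rcons addnS addSn.
rewrite cm addrAC subrr add0r; apply: low_word.
by rewrite size_cat /= addnS.
Qed.

(** The terms of the symmetrization of w agree up to sign modulo shorter words.
The prefix p is what the induction needs, because inserted letters end up in
front of the remaining ones. *)
Lemma wsymm_low p w :
  low m (size p + size w) (wsymm (fun v => m (p ++ v)) w - (size w)`!%:R *: m (p ++ w)).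
Proof.
elim: w p => [|x w IHw] p; first by rewrite wsymm_nil scale1r subrr; apply: low0.
rewrite wsymm_cons; set n : K := (size w).+1%:R.
have -> : wsymm (winsert x (fun v => m (p ++ v))) w =
    n *: wsymm (fun v => m (rcons p x ++ v)) w +
    wsymm (fun u => winsert x (fun v => m (p ++ v)) u - n *: m (p ++ x :: u)) w.
  rewrite -wsymm_lin; apply: eq_wsymm => u _.
  by rewrite cat_rcons addrC subrK.
rewrite /= factS natrM -scalerA -/n addrAC -scalerBr.
rewrite -cat_rcons; apply: lowD.
  by apply: lowZ; have := IHw (rcons p x); rewrite size_rcons addSnnS.
apply: low_sum => s _; apply: lowZ.
by have := winsert_low p x (permw w s); rewrite size_permw addnS.
Qed.

End LowSymmetrization.

#[local] Opaque siota sletter smonom lincoder sympart sproj quotalg_mul quotalg_scale.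
(** * Linear coderivations as functions of the linear map *)

Section LinearCoderivations.
Variables (K : fieldType) (L : gradedLmodType K).
Local Notation SL := (SymCoalg L).

Lemma lincoderS k (f : L -> L) : homlin k f -> forall (x : hom_elt L) (a : SL),
  lincoder f (sletter x * a) =
    siota (f (hval x)) * a + ksign k (hdeg x) *: (sletter x * lincoder f a).
Proof. by move=> hf x a; rewrite (lincoderM hf) -(siota_hval (hmap _ _ _)) hval_hmap. Qed.

Lemma commutator_terms (V : lmodType K) (s b c : K) (A B C D G H : V) : s * s = 1 ->
  A + (s * b) *: C + c *: (D + b *: (s *: G + H)) =
  s *: (B + (s * c) *: D + b *: (C + c *: G)) + (A - s *: B + (b * c) *: H).
Proof.
move=> ss; rewrite !scalerDr !scalerA mulrA ss mul1r.
rewrite [RHS](AC (((2*2)*(2*1))) (((5*3)*(2*(4*7)))*(1*6))) /= subrr addr0.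
congr (_ + (_ + (_ *: _ + _ *: _))); last exact: mulrC.
by rewrite mulrC [X in _ * X]mulrC mulrA.
Qed.

Lemma lincoder_lin k (f g h : L -> L) (c : K) (a : SL) :
  homlin k f -> homlin k g -> homlin k h -> (forall x, h x = c *: f x + g x) ->
  lincoder h a = c *: lincoder f a + lincoder g a.
Proof.
move=> hf hg hh e; move: a.
have lf := lincoder_linear hf; have lg := lincoder_linear hg.
apply: (@sym_lin_eq _ L SL (lincoder h) (fun a => c *: lincoder f a + lincoder g a)).
- exact: lincoder_linear hh.
- exact: lin_comb c lf lg.
elim=> [|x w IHw].
  by rewrite smonom_nil !(lincoder1 hf, lincoder1 hg, lincoder1 hh) scaler0 addr0.
rewrite smonom_cons (lincoderS hf) (lincoderS hg) (lincoderS hh) IHw e.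
rewrite siota_linear mulrDl sym_scalerAl mulrDr sym_scalerAr !scalerDr !scalerA.
by rewrite [c * _]mulrC addrACA.
Qed.

(** The commutator of the derivations extending f and g is the derivation
extending the commutator of f and g. *)
Lemma lincoder_comm k l (f g h : L -> L) (a : SL) :
    homlin k f -> homlin l g -> homlin (k + l) h ->
    (forall x, h x = f (g x) - ksign k l *: g (f x)) ->
  lincoder f (lincoder g a) = ksign k l *: lincoder g (lincoder f a) + lincoder h a.
Proof.
move=> hf hg hh e; move: a.
have lf := lincoder_linear hf; have lg := lincoder_linear hg.
have lh := lincoder_linear hh.
apply: (@sym_lin_eq _ L SL (fun a => lincoder f (lincoder g a))
  (fun a => ksign k l *: lincoder g (lincoder f a) + lincoder h a)).
- exact: lin_comp lf lg.
- exact: (lin_comb _ (lin_comp lg lf)).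
elim=> [|x w IHw].
  rewrite smonom_nil (lincoder1 hf) (lincoder1 hg) (lincoder1 hh).
  by rewrite (lin0 lf) (lin0 lg) scaler0 addr0.
have siotaM F i j' (y : L) (b : SL) : homlin i F -> homog j' y ->
    lincoder F (siota y * b) =
    siota (F y) * b + ksign i j' *: (siota y * lincoder F b).
  move=> hF hy; have := lincoderS hF (hpart j' y) b.
  by rewrite -siota_hval hval_hpart (eqP hy).
have hx := homog_hval x.
rewrite smonom_cons (lincoderS hf) (lincoderS hg) (lincoderS hh).
rewrite (linD lf) (linD lg) (siotaM f k _ _ _ hf (hg.2 _ _ hx)) (siotaM g l _ _ _ hg (hf.2 _ _ hx)).
rewrite (linZ lf) (linZ lg) (lincoderS hf) (lincoderS hg).
rewrite IHw e (linB (@siota_linear K L)) (linZ (@siota_linear K L)) mulrBl sym_scalerAl.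
rewrite mulrDr sym_scalerAr !ksignDr ksignDl.
rewrite (ksignC _ l k); exact: commutator_terms (ksignK _ _ _).
Qed.
End LinearCoderivations.


(** * The operators s(x) *)

Section PreLieOperators.
Variables (K : fieldType) (L : preLieType K).
Local Notation X := (hom_elt L).
Local Notation SL := (SymCoalg L).
Implicit Types (u v w : seq X) (a b : SL).

Lemma prelie_homlin i (x : L) : homog i x -> homlin i (prelie x).
Proof. by move=> hx; split=> [|j y hy]; [exact: prelie_linearr|exact: prelie_homog]. Qed.

Lemma homog_lieb i j (x y : L) : homog i x -> homog j y ->
  lieb x y = x ▷ y - ksign i j *: (y ▷ x).
Proof.
move=> hx hy; rewrite /lieb.
have pl0 (z : L) : z ▷ 0 = 0 by apply: (lin0 (prelie_linearr z)).
have pr0 (z : L) : 0 ▷ z = 0 by apply: (lin0 (prelie_linearl z)).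
rewrite (@gsupp_homog K L L (fun i' x' => \sum_(j' <- gsupp y)
  (x' ▷ gpart j' y - ksign i' j' *: (gpart j' y ▷ x'))) i x) //.
  rewrite (@gsupp_homog K L L (fun j' y' => x ▷ y' - ksign i j' *: (y' ▷ x)) j y) //.
  by move=> j'; rewrite pl0 pr0 scaler0 subr0.
by move=> i'; rewrite big1 // => j' _; rewrite pl0 pr0 scaler0 subr0.
Qed.

Lemma lieb_homog i j (x y : L) : homog i x -> homog j y -> homog (i + j) (lieb x y).
Proof.
move=> hx hy; rewrite (homog_lieb hx hy); apply: homogB; first exact: prelie_homog.
by apply: homogZ; rewrite addrC; apply: prelie_homog.
Qed.

(** The pre-Lie identity says that nabla is a representation. *)
Lemma prelie_lieb i j (x y z : L) : homog i x -> homog j y ->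
  lieb x y ▷ z = x ▷ (y ▷ z) - ksign i j *: (y ▷ (x ▷ z)).
Proof.
move=> hx hy; rewrite (homog_lieb hx hy).
rewrite (linB (prelie_linearl z)) (linZ (prelie_linearl z)).
have /eqP := @prelie_assoc K L i j x y z hx hy.
rewrite scalerBr subr_eq => /eqP ->.
by rewrite [LHS](AC (3*1) ((1*4)*(3*2))) /= subrr add0r.
Qed.

Lemma nablac_linear i (x : L) : homog i x -> linear (nablac x).
Proof. by move/prelie_homlin/lincoder_linear. Qed.

Lemma sop_linear i (x : L) : homog i x -> linear (sop x).
Proof.
move=> /nablac_linear lx c a b; rewrite /sop lx mulrDr sym_scalerAr.
by rewrite scalerDr addrACA.
Qed.

Lemma sop_linl i (c : K) (x y : L) a :
  sop (gpart i (c *: x + y)) a = c *: sop (gpart i x) a + sop (gpart i y) a.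
Proof.
rewrite /sop gpart_linear siota_linear mulrDl sym_scalerAl scalerDr.
rewrite /nablac (@lincoder_lin K L i (prelie (gpart i x)) (prelie (gpart i y)) _ c).
- by rewrite addrACA.
- exact/prelie_homlin/homog_gpart.
- exact/prelie_homlin/homog_gpart.
- by rewrite -gpart_linear; apply/prelie_homlin/homog_gpart.
- by move=> z; apply: (prelie_linearl z).
Qed.

Lemma nablac_siotaM i j (x y : L) a : homog i x -> homog j y ->
  nablac x (siota y * a) =
    siota (x ▷ y) * a + ksign i j *: (siota y * nablac x a).
Proof.
move=> hx hy; have := lincoderS (prelie_homlin hx) (hpart j y) a.
by rewrite -siota_hval hval_hpart (eqP hy).
Qed.

Lemma sop_terms (V : lmodType K) (s : K) (A A' B C C' D E E' : V) :
  s * s = 1 -> A = s *: A' ->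
  A + B + (C + s *: D + E) =
  s *: (A' + D + (C' + s *: B + E')) + (C - s *: C' + (E - s *: E')).
Proof.
move=> ss ->; rewrite !scalerDr !scalerA ss scale1r.
rewrite [RHS](AC (((2*(2*1))*(2*2))) (((1*4)*((6*2)*8)*(3*7))*(5*9))) /=.
by rewrite !subrr !addr0.
Qed.

(** The operators s(x) represent the Lie algebra: the two mixed terms of
[sigma_x + nabla_x, sigma_y + nabla_y] give sigma of the bracket, because nabla_x
is a derivation, and [nabla_x, nabla_y] is nabla of the bracket by the pre-Lie
identity. *)
Lemma sop_comm i j (x y : L) a : homog i x -> homog j y ->
  sop x (sop y a) = ksign i j *: sop y (sop x a) + sop (lieb x y) a.
Proof.
move=> hx hy; rewrite /sop.
rewrite (linD (nablac_linear hx)) (linD (nablac_linear hy)).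
rewrite (nablac_siotaM _ hx hy) (nablac_siotaM _ hy hx).
have mD b b' b'' : b * (b' + b'') = b * b' + b * b'' by exact: mulrDr.
rewrite (mD (siota x) (siota y * a) (nablac y a)) (mD (siota y) (siota x * a) (nablac x a)).
have -> : nablac (lieb x y) a = nablac x (nablac y a) - ksign i j *: nablac y (nablac x a).
  have e z := prelie_lieb z hx hy.
  rewrite /nablac; apply/eqP; rewrite eq_sym subr_eq addrC; apply/eqP.
  exact: lincoder_comm (prelie_homlin hx) (prelie_homlin hy)
    (prelie_homlin (lieb_homog hx hy)) e.
rewrite (homog_lieb hx hy) (linB (@siota_linear K L)) (linZ (@siota_linear K L)).
rewrite mulrBl sym_scalerAl.
rewrite (ksignC _ j i); apply: sop_terms; first exact: ksignK.
rewrite mulrA (siota_homog hx) (siota_homog hy) sletterC !hdeg_hpart.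
by rewrite sym_scalerAl -mulrA.
Qed.

Lemma sopE (x : L) a : sop x a = siota x * a + lincoder (prelie x) a.
Proof. by []. Qed.

Lemma nablacE (x : L) : nablac x = lincoder (prelie x).
Proof. by []. Qed.

#[local] Opaque sop nablac.

Definition weta w : SL := foldr (fun x => sop (hval x)) 1 w.

Lemma weta_wlin : wlin weta.
Proof.
move=> u v i c x y; elim: u => [|z u IHu] /=; first exact: sop_linl.
by rewrite IHu (sop_linear (homog_hval z)).
Qed.

Lemma weta_wcomm : wcomm (@lieb K L) weta.
Proof.
move=> u v x y; elim: u => [|z u IHu] /=.
  have e : hval (hpart (hdeg x + hdeg y) (lieb (hval x) (hval y))) =
      lieb (hval x) (hval y).
    by rewrite hval_hpart (eqP (lieb_homog (homog_hval x) (homog_hval y))).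
  by rewrite e; exact: sop_comm (homog_hval x) (homog_hval y).
by rewrite IHu (sop_linear (homog_hval z)).
Qed.

Lemma letM_low x n a : low (@smonom K L) n a -> low (@smonom K L) n.+1 (sletter x * a).
Proof.
apply: (low_map (h := fun a => sletter x * a)) => [c b b'|w wn].
  by rewrite mulrDr sym_scalerAr.
by rewrite -smonom_cons; apply: low_word.
Qed.

Lemma lincoder_low k (f : L -> L) n a :
  homlin k f -> low (@smonom K L) n a -> low (@smonom K L) n (lincoder f a).
Proof.
move=> hf; apply: low_map => [|w wn]; first exact: lincoder_linear hf.
apply: lowW wn _; elim: w {n a} => [|x w IHw].
  by rewrite smonom_nil (lincoder1 hf); apply: low0.
rewrite smonom_cons (lincoderM hf); apply: lowD; first exact/letM_low/low_word.
exact/lowZ/letM_low.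
Qed.

(** As nabla_x does not increase the word length, s(x) is multiplication by x up to
shorter words. *)
Lemma weta_low w : low (@smonom K L) (size w) (weta w - smonom w).
Proof.
elim: w => [|x w IHw]; first by rewrite smonom_nil subrr; apply: low0.
rewrite smonom_cons /= sopE siota_hval addrAC -mulrBr; apply: lowD.
  exact: letM_low.
apply: (lincoder_low (prelie_homlin (homog_hval x))).
rewrite -[weta w](subrK (smonom w)); apply: lowD; last exact: low_word.
exact: lowW (leqnSn _) IHw.
Qed.

End PreLieOperators.

#[local] Opaque sop nablac.

(** * The enveloping algebra *)

Section EnvelopingAlgebra.
Variables (K : fieldType) (charK : [pchar K] =i pred0) (L : preLieType K).
Local Notation X := (hom_elt L).
Local Notation SL := (SymCoalg L).
Local Notation UL := (EnvAlg L).
Implicit Types (u v w : seq X) (x y : X) (a b : SL) (c : UL).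

Definition emonom w : UL := \prod_(x <- w) eletter x.

Lemma emonom_cons x w : emonom (x :: w) = eletter x * emonom w.
Proof. by rewrite /emonom big_cons. Qed.

Lemma emonom_cat u v : emonom (u ++ v) = emonom u * emonom v.
Proof. by rewrite /emonom big_cat. Qed.

Lemma env_scalerAl (s : K) c c' : s *: c * c' = s *: (c * c').
Proof. by rewrite [RHS]qscalerAl. Qed.

Lemma env_scalerAr (s : K) c c' : c * (s *: c') = s *: (c * c').
Proof. by rewrite [RHS]qscalerAr. Qed.

Lemma env_ind (P : UL -> Prop) : P 0 ->
  (forall s w c, P c -> P (s *: emonom w + c)) -> forall c, P c.
Proof. exact: quot_ind. Qed.

Lemma env_lin_eq (V : lmodType K) (f g : UL -> V) : linear f -> linear g ->
  (forall w, f (emonom w) = g (emonom w)) -> f =1 g.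
Proof. exact: lin_eq. Qed.

Lemma env_vanish (V : lmodType K) (g : seq X -> V) :
    wlin g -> wcomm (@lieb K L) g ->
  forall s r t, @env_rel K L r -> linext g (s * r * t) = 0.
Proof.
move=> lg cg; apply: word_vanish => u v r rr; rewrite -/(linctx g u v r).
have ll := linctx_linear g u v.
case: rr => [i c x y|x y].
  by rewrite 2!(linB ll) [X in _ - X - _](linZ ll) 3!linctx_letter lg -addrA -opprD subrr.
by rewrite (linB ll) linctx_comm linctx_letter cg addrAC addrK subrr.
Qed.

Section Extension.
Variables (V : lmodType K) (g : seq X -> V).
Hypotheses (lg : wlin g) (cg : wcomm (@lieb K L) g).

Lemma envext_mon w : quotext g (emonom w) = g w.
Proof. exact: quotext_mon (env_vanish lg cg) w. Qed.

Lemma envext_linear : linear (quotext g : UL -> V).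
Proof. exact: quotext_linear (env_vanish lg cg). Qed.
End Extension.

Lemma eletter_linear i : linear (fun x : L => eletter (hpart i x)).
Proof.
move=> s x y; apply/eqP; rewrite -subr_eq0 opprD addrA; apply/eqP.
have := qpi_rel (EnvLinear i s x y).
have ll := @qpi_linear K X (@env_rel K L).
by rewrite 2!(linB ll) [X in _ - X - _](linZ ll).
Qed.

Lemma eletter_comm x y : eletter x * eletter y =
  ksign (hdeg x) (hdeg y) *: (eletter y * eletter x)
  + eletter (hpart (hdeg x + hdeg y) (lieb (hval x) (hval y))).
Proof.
apply/eqP; rewrite -subr_eq0 opprD addrA; apply/eqP.
have := qpi_rel (EnvBracket x y).
by rewrite (linB (@qpi_linear K X (@env_rel K L))) qpi_comm.
Qed.

Lemma emonom_wlin : wlin emonom.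
Proof.
move=> u v i s x y; rewrite !emonom_cat !emonom_cons eletter_linear.
by rewrite mulrDl mulrDr env_scalerAl env_scalerAr.
Qed.

Lemma emonom_wcomm : wcomm (@lieb K L) emonom.
Proof.
move=> u v x y; rewrite !emonom_cat !emonom_cons.
rewrite [eletter x * (_ * _)]mulrA eletter_comm mulrDl mulrDr env_scalerAl env_scalerAr.
by rewrite -mulrA.
Qed.

(** ** Symmetrization *)

Definition wsymz w : UL := ((size w)`!%:R)^-1 *: wsymm emonom w.

Lemma fact_neq0 n : (n`!%:R : K) != 0.
Proof. by rewrite (proj1 (pcharf0P K) charK) -lt0n fact_gt0. Qed.

Lemma wsymz_wlin : wlin wsymz.
Proof.
move=> u v i s x y; rewrite /wsymz (wsymm_wlin emonom_wlin) !size_cat /=.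
by rewrite scalerDr !scalerA mulrC.
Qed.

Lemma wsymz_wcomm : wcomm (fun _ _ => 0) wsymz.
Proof.
move=> u v x y; rewrite (wlin0 _ _ _ wsymz_wlin) addr0 /wsymz.
rewrite (wsymm_wcomm emonom_wlin) (wlin0 _ _ _ (wsymm_wlin emonom_wlin)) addr0.
by rewrite !size_cat /= !scalerA mulrC.
Qed.

Lemma symz_linear : linear (@symz K L).
Proof. exact: (symext_linear wsymz_wlin wsymz_wcomm). Qed.

Lemma symz_mon w : symz (smonom w) = wsymz w.
Proof. exact: (symext_mon wsymz_wlin wsymz_wcomm). Qed.

Lemma symz_low w : low emonom (size w) (symz (smonom w) - emonom w).
Proof.
have /(lowZ ((size w)`!%:R)^-1) := wsymm_low emonom_wcomm [::] w.
by rewrite scalerBr scalerA mulVf ?fact_neq0 // scale1r symz_mon.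
Qed.

(** The easy half of the Poincare-Birkhoff-Witt theorem: modulo shorter words a
monomial of UL is the symmetrization of the same monomial of SL. *)
Lemma symz_surj c : exists a, symz a = c.
Proof.
have [n] : exists n, low emonom n c.
  elim/env_ind: c => [|s w c [n cn]]; first by exists 0%N; apply: low0.
  exists (maxn (size w).+1 n); apply: lowS; first by rewrite leq_maxl.
  by apply: lowW cn; rewrite leq_maxr.
elim: n c => [|n IHn] c cn.
  by exists 0; rewrite (lin0 symz_linear) (low_eq0 cn).
elim: cn => [|s w c' wn _ [a <-]]; first by exists 0; apply: lin0 symz_linear.
have [b bE] : exists b, symz b = symz (smonom w) - emonom w.
  by apply: IHn; apply: lowW (symz_low w); rewrite -ltnS.
exists (s *: (smonom w - b) + a).
by rewrite symz_linear (linB symz_linear) bE subKr.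
Qed.

(** ** The map eta *)

Lemma eta_linear : linear (@eta K L).
Proof. exact: (envext_linear (@weta_wlin K L) (@weta_wcomm K L)). Qed.

Lemma eta_mon w : eta (emonom w) = weta w.
Proof. exact: (envext_mon (@weta_wlin K L) (@weta_wcomm K L)). Qed.

(** SL is a module over UL through s, and eta is the action on 1. *)
Lemma etaM x c : eta (eletter x * c) = sop (hval x) (eta c).
Proof.
move: c; apply: (@env_lin_eq _ (fun c => eta (eletter x * c)) (fun c => sop (hval x) (eta c))).
- by move=> s c c'; rewrite mulrDr env_scalerAr eta_linear.
- exact: lin_comp (sop_linear (homog_hval x)) eta_linear.
- by move=> w; rewrite -emonom_cons !eta_mon.
Qed.

(** ** The exponential automorphism *)

Lemma expaut_linear : linear (@expaut K L).
Proof. exact: lin_comp eta_linear symz_linear. Qed.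

(** Both symmetrization and eta preserve the leading word. *)
Lemma expaut_low w : low (@smonom K L) (size w) (expaut (smonom w) - smonom w).
Proof.
have -> : expaut (smonom w) = ((size w)`!%:R)^-1 *: wsymm (@weta K L) w.
  rewrite /expaut /= symz_mon (linZ eta_linear) /wsymm (lin_sum eta_linear).
  by congr (_ *: _); apply: eq_bigr => s _; rewrite (linZ eta_linear) eta_mon.
have -> : wsymm (@weta K L) w =
    1 *: wsymm (@smonom K L) w + wsymm (fun u => weta u - smonom u) w.
  rewrite -wsymm_lin; apply: eq_wsymm => u _.
  by rewrite scale1r addrC subrK.
rewrite scale1r scalerDr addrAC; apply: lowD.
  have /(lowZ ((size w)`!%:R)^-1) := wsymm_low (@smonom_wcomm K L) [::] w.
  by rewrite scalerBr scalerA mulVf ?fact_neq0 // scale1r.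
apply: lowZ; apply: low_sum => s _; apply: lowZ.
by have := weta_low (permw w s); rewrite size_permw.
Qed.

Lemma sym_low a : exists n, low (@smonom K L) n a.
Proof.
elim/sym_ind: a => [|s w c [n cn]]; first by exists 0%N; apply: low0.
exists (maxn (size w).+1 n); apply: lowS; first by rewrite leq_maxl.
by apply: lowW cn; rewrite leq_maxr.
Qed.

Lemma expautK : cancel (@expaut_inv K L) (@expaut K L).
Proof.
move=> a; have [n an] := sym_low a.
have [b ba] := unip_surj expaut_linear expaut_low an.
by rewrite /expaut_inv; case: xgetP => [_ _ //|/(_ b)]; case.
Qed.

Lemma expaut_invK : cancel (@expaut K L) (@expaut_inv K L).
Proof.
move=> a; apply/eqP; rewrite -subr_eq0; apply/eqP.
have [n an] := sym_low (expaut_inv (expaut a) - a).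
apply: (unip_inj expaut_linear expaut_low an).
by rewrite (linB expaut_linear) expautK subrr.
Qed.

End EnvelopingAlgebra.

#[local] Opaque expaut expaut_inv.

(** * Interaction of linear coderivations with the word length *)

Section WordLength.
Variables (K : fieldType) (L : gradedLmodType K).
Local Notation X := (hom_elt L).
Local Notation SL := (SymCoalg L).
Implicit Types (w : seq X) (x : X) (a b : SL) (l : L).

Lemma letM_linear b : linear (fun a : SL => b * a).
Proof. by move=> c a a'; rewrite mulrDr sym_scalerAr. Qed.

Lemma lin_zero (U V : lmodType K) : linear (fun _ : U => 0 : V).
Proof. by move=> c x y; rewrite scaler0 addr0. Qed.

(** The counit of SL, with values in the line spanned by l. *)
Definition sconst l a : L := sproj (siota l * a).

Lemma sconstE l a : sproj (siota l * a) = sconst l a.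
Proof. by []. Qed.

Lemma sconst_linear l : linear (sconst l).
Proof. exact: lin_comp (@sproj_linear K L) (letM_linear (siota l)). Qed.

Lemma sconst_mon l w : sconst l (smonom w) = if w is [::] then l else 0.
Proof. exact: sproj_siotaM. Qed.

#[local] Opaque sconst.

Lemma sconst_letM l x a : sconst l (sletter x * a) = 0.
Proof.
move: a; apply: (@sym_lin_eq _ _ _ (fun a => sconst l (sletter x * a)) (fun=> 0)).
- exact: lin_comp (sconst_linear l) (letM_linear (sletter x)).
- exact: lin_zero.
- by move=> w; rewrite -smonom_cons sconst_mon.
Qed.

Lemma sconst_lincoder k (f : L -> L) l a :
  homlin k f -> sconst l (lincoder f a) = 0.
Proof.
move=> hf; move: a; apply: (@sym_lin_eq _ _ _ (fun a => sconst l (lincoder f a)) (fun=> 0)).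
- exact: lin_comp (sconst_linear l) (lincoder_linear hf).
- exact: lin_zero.
case=> [|x w]; first by rewrite smonom_nil (lincoder1 hf) (lin0 (sconst_linear l)).
rewrite smonom_cons (lincoderM hf) (linD (sconst_linear l)) (linZ (sconst_linear l)).
by rewrite !sconst_letM scaler0 addr0.
Qed.

Lemma sympart_letM n x a : sympart n.+1 (sletter x * a) = sletter x * sympart n a.
Proof.
move: a; apply: (@sym_lin_eq _ _ _ (fun a => sympart n.+1 (sletter x * a))
  (fun a => sletter x * sympart n a)).
- exact: lin_comp (@sympart_linear K L n.+1) (letM_linear (sletter x)).
- exact: lin_comp (letM_linear (sletter x)) (@sympart_linear K L n).
move=> w; rewrite -smonom_cons !sympart_mon /= eqSS smonom_cons.
by case: eqP; rewrite ?mulr0.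
Qed.

Lemma sympart0_letM x a : sympart 0 (sletter x * a) = 0.
Proof.
move: a; apply: (@sym_lin_eq _ _ _ (fun a => sympart 0 (sletter x * a)) (fun=> 0)).
- exact: lin_comp (@sympart_linear K L 0) (letM_linear (sletter x)).
- exact: lin_zero.
- by move=> w; rewrite -smonom_cons sympart_mon.
Qed.

Lemma sympart_lincoder k (f : L -> L) n a :
  homlin k f -> sympart n (lincoder f a) = lincoder f (sympart n a).
Proof.
move=> hf; have ll := lincoder_linear hf; have ls := @sympart_linear K L.
move: a; apply: (@sym_lin_eq _ _ _ (fun a => sympart n (lincoder f a))
  (fun a => lincoder f (sympart n a))).
- exact: lin_comp (ls n) ll.
- exact: lin_comp ll (ls n).
move=> w; elim: w n => [|x w IHw] [|n].
- by rewrite sympart_mon smonom_nil (lincoder1 hf) (lin0 (ls _)).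
- by rewrite sympart_mon smonom_nil (lincoder1 hf) (lin0 (ls _)) (lin0 ll).
- rewrite smonom_cons (lincoderM hf) (linD (ls _)) (linZ (ls _)) !sympart0_letM.
  by rewrite scaler0 addr0 (lin0 ll).
- rewrite smonom_cons (lincoderM hf) (linD (ls _)) (linZ (ls _)) !sympart_letM.
  by rewrite IHw (lincoderM hf).
Qed.

Lemma sproj_sympart n a : n != 1%N -> sproj (sympart n a) = 0.
Proof.
move=> n1; move: a.
apply: (@sym_lin_eq _ _ _ (fun a => sproj (sympart n a)) (fun=> 0)).
- exact: lin_comp (@sproj_linear K L) (@sympart_linear K L n).
- exact: lin_zero.
move=> w; rewrite sympart_mon; case: eqP => [sw|_]; last exact: lin0 (@sproj_linear K L).
by rewrite sproj_mon; case: w sw n1 => [|x [|y w]] //= <-.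
Qed.

Lemma sconst_sympart n l a : sconst l (sympart n.+1 a) = 0.
Proof.
move: a; apply: (@sym_lin_eq _ _ _ (fun a => sconst l (sympart n.+1 a)) (fun=> 0)).
- exact: lin_comp (sconst_linear l) (@sympart_linear K L n.+1).
- exact: lin_zero.
move=> w; rewrite sympart_mon; case: eqP => [sw|_]; last exact: lin0 (sconst_linear l).
by rewrite sconst_mon; case: w sw.
Qed.

Lemma sympart1_siota l : sympart 1 (siota l) = siota l.
Proof.
rewrite (gsuppE l) !(lin_sum (@siota_linear K L)) (lin_sum (@sympart_linear K L 1)).
apply: eq_bigr => i _; rewrite (siota_homog (homog_gpart i l)) -smonom1.
by rewrite sympart_mon.
Qed.

Lemma sympart1E a : sympart 1 a = siota (sproj a).
Proof.
move: a; apply: (@sym_lin_eq _ _ _ (sympart 1) (fun a => siota (sproj a))).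
- exact: sympart_linear.
- exact: lin_comp (@siota_linear K L) (@sproj_linear K L).
move=> w; rewrite sympart_mon sproj_mon.
case: w => [|x [|y w]] /=; last exact: esym (lin0 (@siota_linear K L)).
  exact: esym (lin0 (@siota_linear K L)).
by rewrite siota_hval smonom1.
Qed.

Lemma sproj_siota l : sproj (siota l) = l.
Proof. by rewrite -[siota l]mulr1 -smonom_nil sproj_siotaM. Qed.

Lemma sympart_siotaM n i l a : homog i l ->
  sympart n.+1 (siota l * a) = siota l * sympart n a.
Proof. by move=> hl; rewrite (siota_homog hl) sympart_letM. Qed.

Lemma sympart_prod_siota n (y : 'I_n -> L) :
  sympart n (\prod_(j < n) siota (y j)) = \prod_(j < n) siota (y j).
Proof.
elim: n y => [|n IHn] y; first by rewrite big_ord0 -smonom_nil sympart_mon.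
rewrite big_ord_recl; move: (\prod_(i < n) _) (IHn (fun j => y (lift ord0 j))) => b bE.
rewrite (gsuppE (y ord0)) (lin_sum (@siota_linear K L)) mulr_suml.
rewrite (lin_sum (@sympart_linear K L n.+1)); apply: eq_bigr => i _.
by rewrite (sympart_siotaM _ _ (homog_gpart i _)) bE.
Qed.

Lemma wderiv_homog k (f : L -> L) (g : seq X -> L) (j : int) w :
    (forall u, homog (j + \sum_(x <- u) hdeg x) (g u)) ->
  homog (j + k + \sum_(x <- w) hdeg x) (wderiv k f g w).
Proof.
elim: w g j => [|x w IHw] g j hg /=; first exact: homog0.
rewrite big_cons; apply: homogD.
  by have := hg (hmap k f x :: w); rewrite big_cons hdeg_hpart !addrA.
apply: homogZ; rewrite addrA -[j + k + _]addrAC; apply: IHw => u.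
by have := hg (x :: u); rewrite big_cons addrA.
Qed.

End WordLength.

#[local] Opaque sconst.

(** * The Kapranov brackets of a derivation *)

Section Kapranov.
Variables (K : fieldType) (charK : [pchar K] =i pred0) (L : preLieType K).
Variables (k : int) (d : L -> L).
Hypothesis der_d : lie_derivation k d.
Local Notation X := (hom_elt L).
Local Notation SL := (SymCoalg L).
Local Notation UL := (EnvAlg L).
Implicit Types (u v w : seq X) (x y : X) (a b : SL) (c : UL) (l : L).

Let hd : homlin k d.
Proof. by case: der_d => ld hd _; split. Qed.

Let d_lieb x y : d (lieb (hval x) (hval y)) =
  lieb (d (hval x)) (hval y) + ksign k (hdeg x) *: lieb (hval x) (d (hval y)).
Proof. by case: der_d => _ _; apply; apply: homog_hval. Qed.

(** ** The derivation of UL induced by d *)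

Let wderiv_emonom_wlin := wderiv_wlin hd (@emonom_wlin K L).
Let wderiv_emonom_wcomm :=
  wderiv_wcomm hd (@emonom_wlin K L) (@emonom_wcomm K L) d_lieb.

Definition envder : UL -> UL := quotext (wderiv k d (@emonom K L)).

Lemma envder_linear : linear envder.
Proof. exact: envext_linear wderiv_emonom_wlin wderiv_emonom_wcomm. Qed.

Lemma envder_mon w : envder (emonom w) = wderiv k d (@emonom K L) w.
Proof. exact: (envext_mon wderiv_emonom_wlin wderiv_emonom_wcomm). Qed.

Lemma envderM x c : envder (eletter x * c) =
  eletter (hmap k d x) * c + ksign k (hdeg x) *: (eletter x * envder c).
Proof. by apply: qderM; exact: env_vanish wderiv_emonom_wlin wderiv_emonom_wcomm. Qed.

Lemma symz_lincoder a : symz (lincoder d a) = envder (symz a).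
Proof.
have le := envder_linear.
move: a; apply: (@sym_lin_eq _ _ _ (fun a => symz (lincoder d a)) (fun a => envder (symz a))).
- exact: lin_comp (@symz_linear K L) (lincoder_linear hd).
- exact: lin_comp envder_linear (@symz_linear K L).
move=> w; rewrite (lincoder_mon hd) -(wderiv_map _ _ _ _ (@symz_linear K L)) symz_mon.
rewrite (linZ le) /wsymm (lin_sum le).
under [in RHS]eq_bigr do rewrite (linZ le) envder_mon.
rewrite -/(wsymm (wderiv k d (@emonom K L)) w) -wsymm_wderiv.
rewrite -(wderiv_map _ _ _ _ (h := *:%R _)); last by move=> c t t'; rewrite scalerDr !scalerA mulrC.
by apply: eq_wderiv => u uw; rewrite symz_mon /wsymz uw.
Qed.

(** ** The commutation relation of the conjugated coderivation with s(x) *)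

Local Notation kap := (kmap (lincoder d)).

Lemma kap_expaut a : kap (expaut a) = expaut (lincoder d a).
Proof. by rewrite /kmap /= expaut_invK. Qed.

Lemma expaut_inv_linear : linear (@expaut_inv K L).
Proof.
move=> t a b; rewrite -{1}[a](expautK charK) -{1}[b](expautK charK).
by rewrite -expaut_linear expaut_invK.
Qed.

Lemma kap_linear : linear kap.
Proof.
exact: lin_comp (@expaut_linear K L) (lin_comp (lincoder_linear hd) expaut_inv_linear).
Qed.

(** Under eta the conjugate of d becomes the derivation of UL induced by d, and
s(x) becomes left multiplication by x; hence [K(d), s(x)] = s(dx). *)
Lemma kap_sop i l a : homog i l ->
  kap (sop l a) = sop (d l) a + ksign k i *: sop l (kap a).
Proof.
move=> hl; have -> : l = hval (hpart i l) by rewrite hval_hpart (eqP hl).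
move: (hpart i l) (hdeg_hpart i l) => x <- {i l hl}.
rewrite -[a](expautK charK) kap_expaut; move: (expaut_inv a) => {}a.
have etaE b : expaut b = eta (symz b) by [].
have [b bE] := symz_surj charK (eletter x * symz a).
transitivity (eta (envder (eletter x * symz a))).
  by rewrite [expaut a]etaE -etaM -bE -etaE kap_expaut etaE symz_lincoder.
rewrite envderM (linD (@eta_linear K L)) (linZ (@eta_linear K L)).
congr (_ + _ *: _); first by rewrite etaM (hval_hmap x hd) (etaE a).
by rewrite etaM -symz_lincoder (etaE (lincoder d a)).
Qed.

Lemma kap1 : kap 1 = 0.
Proof.
have e1 : expaut (smonom [::]) = 1 :> SL.
  have -> : expaut (smonom [::]) = eta (symz (smonom [::])) :> SL by [].
  by rewrite symz_mon /wsymz wsymm_nil invr1 scale1r eta_mon.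
rewrite -{1}e1 kap_expaut smonom_nil (lincoder1 hd).
exact: lin0 (@expaut_linear K L).
Qed.

#[local] Opaque kmap.

Lemma kap_siotaM i l a : homog i l -> kap (siota l * a) =
  sop (d l) a + ksign k i *: sop l (kap a) - kap (lincoder (prelie l) a).
Proof.
move=> hl; rewrite -(kap_sop a hl) sopE (linD kap_linear).
by rewrite addrK.
Qed.

Lemma sconst_sop i l l' a : homog i l' -> sconst l (sop l' a) = 0.
Proof.
move=> hl'; rewrite sopE (linD (sconst_linear l)) (siota_homog hl') sconst_letM add0r.
exact: sconst_lincoder (prelie_homlin hl').
Qed.

(** K(d) takes values in the augmentation ideal: by the commutation relation this
passes from shorter words to longer ones, and K(d) kills 1. *)
Lemma sconst_kap l a : sconst l (kap a) = 0.
Proof.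
have ls := sconst_linear l; have lk := kap_linear.
have [n an] := sym_low a.
elim: n a an => [|n IHn] a; first by move/low_eq0->; rewrite (lin0 lk) (lin0 ls).
move=> an; apply: (low_eq0 (m := @wproj K L)).
apply: (low_map (h := fun a => sconst l (kap a)) _ _ an) => [|w wn].
  exact: lin_comp ls lk.
suff -> : sconst l (kap (smonom w)) = 0 by apply: low0.
case: w wn => [|x w] wn; first by rewrite smonom_nil kap1 (lin0 ls).
have hx := homog_hval x.
rewrite smonom_cons -siota_hval (kap_siotaM _ hx) (linB ls) (linD ls) (linZ ls).
have sum0 (A B C : L) (s : K) : A = 0 -> B = 0 -> C = 0 -> A + s *: B - C = 0.
  by move=> -> -> ->; rewrite subr0 scaler0 addr0.
apply: sum0; [exact: sconst_sop (hd.2 _ _ hx)|exact: sconst_sop hx|apply: IHn].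
by apply: (lincoder_low (prelie_homlin hx)); apply: low_word.
Qed.

Lemma sproj_sop l a : sproj (sop l a) = sconst l a + l ▷ sproj a.
Proof.
rewrite sopE (linD (@sproj_linear K L)) sconstE; congr (_ + _).
exact: sproj_lincoder (prelie_linearr l).
Qed.

(** ** The recursion *)

Local Notation kapr := (kapranov d).

Lemma kaprE n a : kapr n a = sproj (kap (sympart n a)).
Proof. by []. Qed.

Lemma kapr_linear n : linear (kapr n).
Proof.
exact: lin_comp (@sproj_linear K L) (lin_comp kap_linear (@sympart_linear K L n)).
Qed.

Lemma kapr_sympart n a : kapr n (sympart n a) = kapr n a.
Proof. by rewrite !kaprE sympart_id. Qed.

#[local] Opaque kapranov.

(** Projecting the commutation relation to L. The term sigma_x K(d) contributes
nothing, as K(d) has no component in the ground field. *)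
Lemma kapr_siotaM n i l a : homog i l -> sympart n a = a ->
  kapr n.+1 (siota l * a) =
    sconst (d l) a + d l ▷ sproj a
    - (kapr n (nablac l a) - ksign k i *: (l ▷ kapr n a)).
Proof.
move=> hl an; rewrite !kaprE nablacE (sympart_siotaM _ _ hl).
rewrite (sympart_lincoder _ _ (prelie_homlin hl)) an (kap_siotaM _ hl).
rewrite (linB (@sproj_linear K L)) (linD (@sproj_linear K L)) (linZ (@sproj_linear K L)).
rewrite opprB addrA; congr (_ + _ *: _ - _); first exact: sproj_sop.
by rewrite sproj_sop sconst_kap add0r.
Qed.

Lemma kapr0 a : kapr 0 a = 0.
Proof.
move: a; apply: (@sym_lin_eq _ _ _ (kapr 0) (fun=> 0)).
- exact: kapr_linear.
- exact: lin_zero.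
move=> w; rewrite kaprE sympart_mon; case: eqP => [/size0nil->|_].
  by rewrite smonom_nil kap1; apply: lin0 (@sproj_linear K L).
by rewrite (lin0 kap_linear); apply: lin0 (@sproj_linear K L).
Qed.

Lemma kapr1 l : kapr 1 (siota l) = d l.
Proof.
have ld : linear d := hd.1.
rewrite (gsuppE l) (lin_sum (@siota_linear K L)) (lin_sum (kapr_linear 1)) (lin_sum ld).
apply: eq_bigr => i _; have hl := homog_gpart i l.
rewrite -[siota _]mulr1 (kapr_siotaM hl); last by rewrite -smonom_nil sympart_mon.
rewrite !kapr0 (lin0 (prelie_linearr _)) scaler0 subr0 subr0.
by rewrite -smonom_nil sconst_mon sproj_mon (lin0 (prelie_linearr _)) addr0.
Qed.

Lemma sproj_nrbracket n i l (q : SL -> L) a : linear q ->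
  (forall b, q (sympart n b) = q b) ->
  sproj (nrbracket k i (coder1 n q) (nablac l) a) =
    q (nablac l a) - ksign k i *: (l ▷ q a).
Proof.
move=> lq qn; rewrite /nrbracket (linB (@sproj_linear K L)) (linZ (@sproj_linear K L)).
congr (_ - _ *: _); first by rewrite (sproj_coder1 _ _ lq) qn.
by rewrite nablacE (sproj_lincoder _ (prelie_linearr l)) (sproj_coder1 _ _ lq) qn.
Qed.

Lemma kapr2 i l l' : homog i l -> kapr 2 (siota l * siota l') =
  d l ▷ l' - sproj (nrbracket k i (lincoder d) (nablac l) (siota l')).
Proof.
move=> hl; rewrite (kapr_siotaM hl (sympart1_siota l')).
have -> : lincoder d = coder1 1 (d \o @sproj K L) by [].
have k1 a : kapr 1 a = d (sproj a) by rewrite -kapr_sympart sympart1E kapr1.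
rewrite sproj_nrbracket; first last.
- by move=> b /=; rewrite sympart1E sproj_siota.
- exact: lin_comp hd.1 (@sproj_linear K L).
have e : sconst (d l) (siota l') + d l ▷ sproj (siota l') = d l ▷ l'.
  by rewrite -{1}(sympart1_siota l') sconst_sympart add0r sproj_siota.
by congr (_ - (_ - _ *: (_ ▷ _))); [exact: e|exact: k1|exact: k1].
Qed.

Lemma kaprS n i l a : (2 <= n)%N -> homog i l -> sympart n a = a ->
  kapr n.+1 (siota l * a) =
    - sproj (nrbracket k i (coder1 n (kapr n)) (nablac l) a).
Proof.
case: n => [|[|n]] // _ hl an.
have e : sconst (d l) a + d l ▷ sproj a = 0.
  by rewrite -an sconst_sympart sproj_sympart // (lin0 (prelie_linearr _)) addr0.
rewrite (kapr_siotaM hl an) (sproj_nrbracket _ _ _ (kapr_linear _) (@kapr_sympart _)).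
by rewrite -[RHS]sub0r; congr (_ - _).
Qed.

(** The recursion propagates homogeneity from words of length n to length n+1. *)
Lemma kapr_symmap n : symmap n k (kapr n).
Proof.
split; [exact: kapr_linear|exact: kapr_sympart|].
elim: n => [|n IHn] w; first by rewrite kapr0; apply: homog0.
case: w => [|x w].
  by rewrite -kapr_sympart sympart_mon (lin0 (kapr_linear _)); apply: homog0.
have hx := homog_hval x; rewrite -kapr_sympart sympart_mon; case: eqP => [[wn]|_]; last first.
  by rewrite (lin0 (kapr_linear _)); apply: homog0.
rewrite smonom_cons -siota_hval (kapr_siotaM hx); last by rewrite sympart_mon wn eqxx.
rewrite sconst_mon sproj_mon big_cons.
apply: homogB; first apply: homogD; last apply: homogB.
- case: w {wn} => [|y w]; last exact: homog0.
  by rewrite big_nil addr0; apply: hd.2.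
- case: w {wn} => [|y [|z w]]; rewrite ?(lin0 (prelie_linearr _)); try exact: homog0.
  by rewrite big_seq1 addrA; apply: prelie_homog; [apply: hd.2|apply: homog_hval].
- rewrite nablacE (lincoder_mon (prelie_homlin hx)) -(wderiv_map _ _ _ _ (kapr_linear n)).
  by rewrite addrA; apply: wderiv_homog.
- by apply: homogZ; rewrite addrCA; apply: prelie_homog.
Qed.

End Kapranov.

Theorem proposition3p12 (K : fieldType) (charK : [pchar K] =i pred0)
    (L : preLieType K) (k : int) (d : L -> L) (der_d : lie_derivation k d) :
  (forall n : nat, symmap n k (kapranov d n)) /\
  forall q : nat -> SymCoalg L -> L, (forall n : nat, symmap n k (q n)) ->
    ((forall (n : nat) (v : SymCoalg L), q n v = kapranov d n v) <->
     [/\ forall v : SymCoalg L, q 0%N v = 0,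
         forall x : L, q 1%N (siota x) = d x,
         forall (i : int) (x y : L), homog i x ->
           q 2%N (siota x * siota y) =
             d x ▷ y - sproj (nrbracket k i (lincoder d) (nablac x) (siota y))
       & forall (n : nat) (i : int) (x : L) (y : 'I_n -> L),
           (2 <= n)%N -> homog i x ->
           q n.+1 (siota x * \prod_(j < n) siota (y j)) =
             - sproj (nrbracket k i (coder1 n (q n)) (nablac x)
                        (\prod_(j < n) siota (y j)))]).
Proof.
split=> [n|q q_sym]; first exact: kapr_symmap.
split=> [qE|[q0 q1 q2 qS] n].
  have qEf n : q n = kapranov d n by apply: funext => a; apply: qE.
  split=> [a|x|i x y hx|n i x y n2 hx]; rewrite !qEf.
  - exact: (kapr0 charK der_d).
  - exact: (kapr1 charK der_d).
  - exact: (kapr2 charK der_d _ hx).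
  - exact: (kaprS charK der_d n2 hx (sympart_prod_siota y)).
elim: n => [|n IHn] v; first by rewrite q0 (kapr0 charK der_d).
have [lq qn _] := q_sym n.+1.
have qf : q n = kapranov d n by apply: funext.
have lk := kapr_linear charK der_d n.+1.
have kn := @kapr_sympart K L d n.+1.
move: v; apply: (@sym_lin_eq _ _ _ (q n.+1) (kapranov d n.+1)) => // w.
rewrite -qn -kn sympart_mon; case: eqP => [wn|_]; last by rewrite (lin0 lq) (lin0 lk).
case: w wn {lq qn lk kn} => // x w [wn]; have hx := homog_hval x.
rewrite -{}wn in qf *; case: (ltnP 1 (size w)) => [w2|].
  rewrite smonom_cons_prod (qS _ _ _ _ w2 hx) qf; symmetry.
  exact: (kaprS charK der_d w2 hx (sympart_prod_siota _)).
case: w {qf} => [|y [|z w]] // _.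
  by rewrite smonom1 -siota_hval q1 (kapr1 charK der_d).
rewrite smonom_cons smonom1 -(siota_hval x) -(siota_hval y).
by rewrite (q2 _ _ _ hx) (kapr2 charK der_d _ hx).
Qed.
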